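(* Let $\mathfrak G=(\mathfrak X,\mathfrak E)$ be a finite connected graph with at least one edge and without dead ends, with cyclomatic number $\mathfrak c(\mathfrak G)$. The spectral parameter $z=1$ is exceptional, i.e. the map $\mathcal D'(\widetilde\Omega)^{\Gamma,1}\to\mathcal E_{\chi(1)}(\Delta;\mathrm{Maps}(\mathfrak X,\mathbb C))$ induced by the vertex Poisson transform $\mathcal P_1$ is not bijective. More precisely, $$\dim_{\mathbb C}\big(\mathrm{im}(\mathcal P_1|_{\mathcal D'(\widetilde\Omega)^{\Gamma,1}})\big)=\begin{cases}0&\text{if }\mathfrak c(\mathfrak G)\neq1,\\1&\text{if }\mathfrak c(\mathfrak G)=1,\end{cases}$$ and $$\dim_{\mathbb C}(\mathcal D'(\widetilde\Omega)^{\Gamma,1})=\dim_{\mathbb C}\big(\mathcal E_1(\Delta^{\mathrm e};\mathrm{Maps}(\mathfrak E,\mathbb C))\big)=\begin{cases}\mathfrak c(\mathfrak G)&\text{if }\mathfrak c(\mathfrak G)\neq1,\\2&\text{if }\mathfrak c(\mathfrak G)=1.\end{cases}$$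
   Context: Graphs: $\mathfrak X$ is the set of vertices and $\mathfrak E\subseteq\mathfrak X^2$ the set of directed edges, symmetric under $(a,b)\mapsto(b,a)$, without loops. For $\vec e=(a,b)$ put $\iota(\vec e)=a$, $\tau(\vec e)=b$, $\vec e^{\,\mathrm{op}}=(b,a)$. No dead ends: every directed edge starts an infinite non-backtracking chain of concatenated edges. The cyclomatic number is $\mathfrak c(\mathfrak G)=(\text{number of undirected edges})-|\mathfrak X|+1$. Laplacians: $q_x+1$ is the number of neighbors of $x$; $\Delta f(x)=\frac1{q_x+1}\sum_{\iota(\vec e)=x}f(\tau(\vec e))$; $\chi(z)(x)=\frac{z+q_xz^{-1}}{q_x+1}$; $\mathcal E_{\chi(z)}(\Delta;\mathrm{Maps}(\mathfrak X,\mathbb C))=\{f\mid\Delta f(x)=\chi(z)(x)f(x)\ \forall x\}$. $\Delta^{\mathrm e}f(\vec e)=\sum_{\iota(\vec e\,')=\tau(\vec e),\ \vec e\,'\neq\vec e^{\,\mathrm{op}}}f(\vec e\,')$ and $\mathcal E_z(\Delta^{\mathrm e};\mathrm{Maps}(\mathfrak E,\mathbb C))=\{f\mid\Delta^{\mathrm e}f=zf\}$. Universal cover: $\widetilde{\mathfrak G}=(\widetilde{\mathfrak X},\widetilde{\mathfrak E})$ is the simply connected cover of the underlying undirected graph (each undirected edge replaced by two opposite directed ones), a tree; $\Gamma$ is the group of deck transformations. $\widetilde\Omega$ is the boundary of $\widetilde{\mathfrak G}$: infinite non-backtracking vertex paths modulo sharing infinitely many vertices; $[x,\omega[$ is the representative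 of $\omega$ starting at $x$; $\partial_+\vec e$ is the set of $\omega$ such that $[\iota(\vec e),\omega[$ starts with $\vec e$; these sets generate the topology. $\mathcal D'(\widetilde\Omega)$ is the algebraic dual of the space of locally constant functions $\widetilde\Omega\to\mathbb C$. Fix $o\in\widetilde{\mathfrak X}$; $\langle x,\omega\rangle=d(o,y)-d(x,y)$ where $[o,\omega[\,\cap\,[x,\omega[\,=[y,\omega[$. For $z\neq0$: $\mathcal P_z\mu(x)=\int_{\widetilde\Omega}z^{\langle x,\omega\rangle}d\mu(\omega)$ for $x\in\widetilde{\mathfrak X}$; for an automorphism $g$ of $\widetilde{\mathfrak G}$, $\pi_z(g)\mu=g_*\big(z^{-\langle go,g\,\cdot\,\rangle}\mu\big)$ (multiply by the function $\omega\mapsto z^{-\langle go,g\omega\rangle}$, then push forward by $g$); $\mathcal D'(\widetilde\Omega)^{\Gamma,z}=\{\mu\mid\pi_z(\gamma)\mu=\mu\ \forall\gamma\in\Gamma\}$. For $\mu\in\mathcal D'(\widetilde\Omega)^{\Gamma,z}$ the function $\mathcal P_z\mu$ is $\Gamma$-invariant and so is identified with a function on $\mathfrak X$, lying in $\mathcal E_{\chi(z)}(\Delta;\mathrm{Maps}(\mathfrak X,\mathbb C))$. *)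

(* Defs.v *)
(* MathComp and MathComp-Analysis; the complex numbers are R[i] for R : realType. *)
From HB Require Import structures.
From mathcomp Require Import all_boot all_order all_algebra.
From mathcomp Require Import all_real_closed.
From mathcomp Require Import boolp classical_sets functions cardinality filter.
From mathcomp Require Import reals topology.

Set Implicit Arguments.
Unset Strict Implicit.
Unset Printing Implicit Defensive.
Import Order.TTheory GRing.Theory Num.Theory.
Local Open Scope classical_set_scope.
Local Open Scope ring_scope.

(* A graph on the vertex type T is given by its adjacency relation: the
   directed edges are the pairs (a, b) with e a b. *)
Section Graphs.
Variables (T : eqType) (e : rel T).

Definition is_graph := symmetric e /\ irreflexive e.

Definition connected_graph :=
  forall x y : T, exists2 s : seq T, path e x s & last x s = y.

Definition is_tree := [/\ is_graph, connected_graph &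
  forall c : seq T, ucycle e c -> (size c <= 2)%N].

Definition nbpath : set (nat -> T) :=
  [set p | forall n, e (p n) (p n.+1) /\ p n.+2 <> p n].

Definition no_dead_ends :=
  forall a b, e a b -> exists2 p, nbpath p & p 0%N = a /\ p 1%N = b.

Definition graph_dist (x y : T) : nat := xget 0%N
  [set n | (exists s, [/\ path e x s, last x s = y & size s = n]) /\
           forall s, path e x s -> last x s = y -> (n <= size s)%N].

Definition graph_aut (g : T -> T) :=
  bijective g /\ forall x y, e (g x) (g y) = e x y.

End Graphs.

Definition num_edges (X : finType) (e : rel X) : nat :=
  #|[set [set a.1; a.2] | a in [set b : X * X | e b.1 b.2]]%SET|.

Definition cyclomatic (X : finType) (e : rel X) : int :=
  (num_edges e)%:Z - #|X|%:Z + 1.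

(* The dimension is an int so as to be directly comparable with [cyclomatic]. *)
Definition has_dim (K : fieldType) (V : lmodType K) (S : set V) (d : int) :=
  exists n (b : 'I_n -> V), [/\ d = n%:Z,
    forall c : 'I_n -> K, \sum_i c i *: b i = 0 -> forall i, c i = 0 &
    forall v, S v <-> exists c : 'I_n -> K, v = \sum_i c i *: b i].

Section Laplacians.
Variables (K : fieldType) (X : finType) (e : rel X).

Definition branching (x : X) : K := #|[set y | e x y]%SET|%:R - 1.

Definition laplacian (f : X -> K) (x : X) : K :=
  (branching x + 1)^-1 * \sum_(y | e x y) f y.

Definition chi (z : K) (x : X) : K :=
  (z + branching x * z^-1) / (branching x + 1).

Definition vertex_eigenspace (z : K) : set (X -> K^o) :=
  [set f | forall x, laplacian f x = chi z x * f x].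

Definition dedge := {a : X * X | e a.1 a.2}.

Definition edge_laplacian (f : dedge -> K) (a : dedge) : K :=
  \sum_(b : dedge | ((val b).1 == (val a).2) &&
                    (val b != ((val a).2, (val a).1))) f b.

Definition edge_eigenspace (z : K) : set (dedge -> K^o) :=
  [set f | forall a, edge_laplacian f a = z * f a].

End Laplacians.

(* Simply connected covers of graphs are the covering trees. *)
Definition is_universal_cover (X : finType) (e : rel X)
    (Xt : choiceType) (et : rel Xt) (p : Xt -> X) :=
  [/\ is_tree et, set_surj [set: Xt] [set: X] p &
      forall x, set_bij [set y | et x y] [set b | e (p x) b] p].

Definition deck (X : finType) (Xt : choiceType) (et : rel Xt) (p : Xt -> X) :
    set (Xt -> Xt) :=
  [set g | graph_aut et g /\ forall x, p (g x) = p x].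

Section Boundary.
Variables (Xt : choiceType) (et : rel Xt).

(* In a tree, sharing infinitely many vertices is an equivalence relation on
   non-backtracking paths; an end is represented by its class.  There too, the
   points chosen with xget below (the representative [x,w[ of an end, the
   vertex where two of them meet) exist and are unique. *)
Definition end_class (p : nat -> Xt) : set (nat -> Xt) :=
  [set q | nbpath et q /\ infinite_set (range p `&` range q)].

Definition ends : set (set (nat -> Xt)) := [set end_class p | p in nbpath et].

Record boundary := Boundary {
  bd_val : set (nat -> Xt);
  _ : bd_val \in ends }.

HB.instance Definition _ := [isSub for bd_val].
HB.instance Definition _ := [Choice of boundary by <:].

Definition ray (x : Xt) (w : boundary) : nat -> Xt :=
  xget (fun=> x) [set p | val w p /\ p 0%N = x].

(* The set written $\partial_+$ a; these sets, for a a directed edge, generate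
   the topology of the boundary. *)
Definition cone (a : Xt * Xt) : set boundary :=
  [set w | ray a.1 w 1%N = a.2].

HB.instance Definition _ := @isSubBaseTopological.Build boundary
  (set boundary) [set cone a | a in [set a | et a.1 a.2]] id.

Definition confluence (x y : Xt) (w : boundary) : Xt := xget x
  [set v | range (ray x w) `&` range (ray y w) = range (ray v w)].

Definition horocycle (o x : Xt) (w : boundary) : int :=
  let y := confluence o x w in
  (graph_dist et o y)%:Z - (graph_dist et x y)%:Z.

(* For an automorphism g the image of an end is an end (see [bd_actE]), so
   that the default value of insubd is not used. *)
Definition bd_act (g : Xt -> Xt) (w : boundary) : boundary :=
  insubd w [set g \o q | q in val w].

Lemma bd_actE g w : graph_aut et g ->
  val (bd_act g w) = [set g \o q | q in val w].
Proof.
move=> [[h gK hK] ge]; rewrite /bd_act insubdK //.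
have nbg q : nbpath et q -> nbpath et (g \o q).
  by move=> nq n /=; have [en nn] := nq n; rewrite ge; split=> // /(can_inj gK).
have nbh q : nbpath et q -> nbpath et (h \o q).
  move=> nq n /=; have [en nn] := nq n; split; last by move/(can_inj hK).
  by rewrite -ge !hK.
case: w => w /= /[1!inE] -[p np <-]; rewrite inE.
have rg q : range (g \o q) = g @` range q by rewrite image_comp.
exists (g \o p); first exact: nbg.
have inf (A : set Xt) : infinite_set (g @` A) <-> infinite_set A.
  split=> iA fA; apply: iA; first exact: finite_image.
  have -> : A = h @` (g @` A); last exact: finite_image.
  by rewrite image_comp (_ : h \o g = id) ?image_id//; apply/funext => x /=.
have gI A B : g @` (A `&` B) = g @` A `&` g @` B.
  apply/seteqP; split=> [_ [x [Ax Bx] <-]|_ [[x Ax <-] [y By /(can_inj gK) yx]]].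
    by split; exists x.
  by exists x => //; split=> //; rewrite -yx.
apply/seteqP; split=> [q [nq iq]|_ [q [nq iq] <-]].
  have qE : q = g \o (h \o q) by apply/funext => n /=; rewrite hK.
  exists (h \o q) => //; split; first exact: nbh.
  by apply/inf; rewrite gI -!rg -qE.
by split; [exact: nbg | rewrite !rg -gI; apply/inf].
Qed.

End Boundary.

Section LocallyConstant.
Variables (K : fieldType) (Xt : choiceType) (et : rel Xt).
Local Notation Omega := (boundary et).

Definition loc_const : {pred Omega -> K^o} :=
  [pred f : Omega -> K^o |
    `[< forall w : Omega, \forall w' \near w, f w' = f w >]].

Lemma loc_const_submod : submod_closed loc_const.
Proof.
split; first by apply/asboolP => w; near=> w'.
move=> c f g /asboolP lf /asboolP lg; apply/asboolP => w.
near=> w'; have fw : f w' = f w by near: w'; exact: lf.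
have gw : g w' = g w by near: w'; exact: lg.
by rewrite /= [LHS]/(c *: f w' + g w') fw gw.
Unshelve. all: by end_near. Qed.

HB.instance Definition _ :=
  GRing.isSubmodClosed.Build K (Omega -> K^o) loc_const loc_const_submod.

Record loc_const_fun := LocConstFun {
  loc_const_val :> Omega -> K^o;
  _ : loc_const_val \in loc_const }.

HB.instance Definition _ := [isSub for loc_const_val].
HB.instance Definition _ := [Choice of loc_const_fun by <:].
HB.instance Definition _ := [SubChoice_isSubLmodule of loc_const_fun by <:].

End LocallyConstant.

Section Poisson.
Variables (K : fieldType) (X : finType) (e : rel X).
Variables (Xt : choiceType) (et : rel Xt) (p : Xt -> X) (o : Xt).
Local Notation Omega := (boundary et).
Local Notation functional := (loc_const_fun K et -> K^o).

Definition distribution : set functional := [set mu | scalar mu].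

(* The value is only meaningful for a locally constant function f, which the
   integrands below are for z != 0 and g a graph automorphism. *)
Definition integral (mu : functional) (f : Omega -> K) : K :=
  mu (insubd (0 : loc_const_fun K et) (f : Omega -> K^o)).

Definition poisson (z : K) (mu : functional) (x : Xt) : K :=
  integral mu (fun w => z ^ horocycle o x w).

(* The action pi_z(g), with g_* nu the functional f |-> nu (f \o g). *)
Definition twisted_action (z : K) (g : Xt -> Xt) (mu : functional) : functional :=
  fun f => integral mu
    (fun w => z ^ (- horocycle o (g o) (bd_act g w)) * f (bd_act g w)).

Definition inv_distribution (z : K) : set functional :=
  [set mu | distribution mu /\
            forall g, deck et p g -> twisted_action z g mu = mu].

(* The Poisson transform on invariant distributions, read as a function on X
   by evaluating it at some lift of each vertex. *)
Definition vertex_poisson (z : K) (mu : functional) : X -> K^o :=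
  fun x => poisson z mu (xget o [set xt | p xt = x]).

Lemma poisson1E mu x y : poisson 1 mu x = poisson 1 mu y.
Proof.
by rewrite /poisson; congr integral; apply/funext => w; rewrite !exp1rz.
Qed.

Lemma vertex_poisson1E mu x : vertex_poisson 1 mu (p x) = poisson 1 mu x.
Proof. exact: poisson1E. Qed.

Lemma vertex_poisson1_fun :
  set_fun (inv_distribution 1) (vertex_eigenspace e 1) (vertex_poisson 1).
Proof.
move=> mu _ x; rewrite /laplacian /chi /vertex_poisson.
rewrite (eq_bigr (fun=> poisson 1 mu o)); last by move=> y _; exact: poisson1E.
rewrite sumr_const (poisson1E mu _ o) invr1 mulr1 -mulr_natl /branching cardsE.
by rewrite [1 + _]addrC subrK mulrA [_^-1 * _]mulrC.
Qed.

End Poisson.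

Arguments edge_eigenspace {K X} e z.
Arguments inv_distribution {K X Xt} et p o z.
Arguments vertex_poisson {K X Xt} et p o z.

(* Main.v *)
(* A Gamma-invariant distribution mu is determined by its masses
   u a = mu (cone of a lift of a), because locally constant functions on the
   boundary are finite combinations of indicators of cones.  The cone of an edge
   is the disjoint union of the cones of its successors, so u is fixed by the
   edge Laplacian; conversely every fixed u extends to an additive invariant
   mass.  Thus the invariant distributions are the solutions of
   u a + u a^op = C for all edges a and sum_(a from x) u a = C for all vertices x,
   where C = mu (boundary) is also the constant value of the Poisson transform
   at z = 1.  Summing over all directed edges gives |E| C = |X| C, so C = 0
   unless the graph has cyclomatic number 1.  The dimension is that of the kernel
   of the linear system in (u on an orientation, C), whose left kernel consists of
   the constants k such that k (|E| - |X|) = 0. *)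
Require Import Defs.
From HB Require Import structures.
From mathcomp Require Import all_boot all_order all_algebra.
From mathcomp Require Import all_real_closed.
From mathcomp Require Import zify ring.
From mathcomp Require Import boolp classical_sets functions cardinality filter.
From mathcomp Require Import reals topology.

Set Implicit Arguments.
Unset Strict Implicit.
Unset Printing Implicit Defensive.
Import Order.TTheory GRing.Theory Num.Theory.
Local Open Scope classical_set_scope.
Local Open Scope ring_scope.

Lemma connected_ind (T : eqType) (e : rel T) (P : T -> Prop) x :
  connected_graph e -> (forall y z, e y z -> P y -> P z) -> P x ->
  forall y, P y.
Proof.
move=> conn Pe Px y; have [s] := conn x y.
elim: s x Px => [|z s IH] x Px /=; first by move=> _ <-.
by move=> /andP[/Pe/(_ Px) Pz]; exact: IH.
Qed.

(** * Non-backtracking paths and the boundary of a tree *)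

Section Walks.
Variables (T : eqType) (e : rel T).
Hypothesis e_tree : is_tree e.

Lemma tree_sym x y : e x y = e y x.
Proof. by case: e_tree => -[]. Qed.

Lemma tree_irr x : e x x = false.
Proof. by case: e_tree => -[]. Qed.

Lemma tree_connected : connected_graph e.
Proof. by case: e_tree. Qed.

(** A finite walk of n steps is encoded by a total function whose values beyond n are irrelevant, so
    that walks can be reversed and glued by arithmetic on indices. *)
Definition nbwalk (q : nat -> T) n :=
  (forall i, (i < n)%N -> e (q i) (q i.+1)) /\
  (forall i, (i.+1 < n)%N -> q i.+2 <> q i).

(** Strong induction on j - i: for a closest repetition the vertices from q i to q (j - 1) are
    distinct and form a cycle, which in a tree has length at most 2. Length 1 would be a loop,
    length 2 a backtracking. *)
Lemma nbwalk_inj q n i j :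
  nbwalk q n -> (i < j <= n)%N -> q i <> q j.
Proof.
move=> [qe qnb].
have [d] := ubnP (j - i); elim: d i j => // d IH i j dij /andP[ij jn] qij.
have jE : j = (i + (j - i).-1.+1)%N by lia.
move: (j - i).-1 jE => k jE.
(* The cycle has k + 1 = j - i vertices; the induction hypothesis makes them distinct. *)
have [_ _ /(_ (mkseq (fun l => q (i + l)%N) k.+1))] := e_tree.
rewrite size_mkseq => /(_ _)/wrap[].
  apply/andP; split; last first.
    apply/mkseq_uniqP => a b; rewrite !inE => ak bk.
    have [ab|ba|//] := ltngtP a b.
      by move=> qab; case: (IH (i + a)%N (i + b)%N) => //; lia.
    by move=> qab; case: (IH (i + b)%N (i + a)%N) => //; lia.
  have -> : mkseq (fun l => q (i + l)%N) k.+1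
      = q i :: mkseq (fun l => q (i + l.+1)%N) k.
    rewrite /mkseq /= addn0; congr (_ :: _).
    by rewrite -[1%N]addn0 iotaDl -map_comp; apply: eq_map => l /=.
  rewrite /= [X in rcons _ X]qij jE.
  rewrite -[rcons _ _]/(rcons _ ((fun l => q (i + l.+1)%N) k)).
  rewrite -mkseqS; apply/(pathP (q i)) => l; rewrite size_mkseq => lk.
  rewrite nth_mkseq//; case: l lk => [|l] lk /=.
    by rewrite addn1; apply: qe; lia.
  rewrite nth_mkseq; last by lia.
  by rewrite [(i + l.+2)%N]addnS; apply: qe; lia.
case: k jE => [|[|//]] jE _.
  by have := qe i; rewrite -addn1 -jE -qij tree_irr; case/(_ ltac:(lia)).
by apply: (qnb i); [lia | rewrite qij jE !addnS addn0].
Qed.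

Lemma nbpath_shift q k : nbpath e q -> nbpath e (fun n => q (k + n)%N).
Proof. by move=> nq n; have := nq (k + n)%N; rewrite !addnS. Qed.

Lemma nbpath_cons x q : nbpath e q -> e x (q 0%N) -> q 1%N <> x ->
  nbpath e (fun n => if n is m.+1 then q m else x).
Proof. by move=> nq xq qx [|n] //=; split=> //; have [] := nq n. Qed.

Lemma nbpath_inj q i j : nbpath e q -> q i = q j -> i = j.
Proof.
move=> nq qij.
have wq n : nbwalk q n by split=> l _; have [] := nq l.
have [ij|ji|//] := ltngtP i j.
  by case: (nbwalk_inj (wq j) _ qij); rewrite ij leqnn.
by case: (nbwalk_inj (wq i) _ (esym qij)); rewrite ji leqnn.
Qed.

(* If the paths separate and meet again, going back along the first one and forth
   along the second one is a closed non-backtracking walk. *)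
Lemma nbpath_meet q q' i j : nbpath e q -> nbpath e q' -> q 0%N = q' 0%N ->
  q i = q' j -> i = j /\ forall k, (k <= i)%N -> q k = q' k.
Proof.
elim: i j q q' => [|i IH] [|j] q q' nq nq' q0 qij.
- by split=> // k; rewrite leqn0 => /eqP ->.
- by have := nbpath_inj nq' (etrans (esym q0) qij).
- by have := nbpath_inj nq (etrans qij (esym q0)).
have [q1|q1] := pselect (q 1%N = q' 1%N).
  have [] := IH j _ _ (nbpath_shift 1 nq) (nbpath_shift 1 nq') q1 qij.
  by move=> -> h; split=> // -[//|k] /h; rewrite !add1n.
exfalso.
pose h k := if (k <= i.+1)%N then q (i.+1 - k)%N else q' (k - i.+1)%N.
have : nbwalk h (i.+1 + j.+1)%N.
  split=> k kn; rewrite /h.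
    have [ki|ik] := leqP k.+1 i.+1.
      rewrite ltnW// tree_sym; have [+ _] := nq (i.+1 - k.+1)%N.
      by have -> : (i.+1 - k.+1).+1 = (i.+1 - k)%N by lia.
    case: (leqP k i.+1) => ik'.
      have -> : (i.+1 - k = 0)%N by lia.
      have -> : (k.+1 - i.+1 = 1)%N by lia.
      by rewrite q0; have [] := nq' 0%N.
    by have [+ _] := nq' (k - i.+1)%N; rewrite subSn.
  have [ki|ik] := leqP k.+2 i.+1.
    rewrite (ltnW (ltnW ki)); have [_] := nq (i.+1 - k.+2)%N.
    have -> : ((i.+1 - k.+2).+2 = i.+1 - k)%N by lia.
    by move=> h1 h2; apply: h1.
  case: (leqP k i.+1) => ik'; last first.
    by have [_] := nq' (k - i.+1)%N; rewrite !subSn//; lia.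
  (* The turning point q 0 is h (i + 1). The triple starting there lies on q'; the triple centred
     there goes from q 1 to q' 1, which differ by assumption. *)
  have [kE|kE] : k = i.+1 \/ k = i by lia.
    rewrite kE subnn; have -> : (i.+3 - i.+1 = 2)%N by lia.
    by rewrite q0; have [_] := nq' 0%N.
  rewrite kE; have -> : (i.+2 - i.+1 = 1)%N by lia.
  have -> : (i.+1 - i = 1)%N by lia.
  exact: nesym.
move/nbwalk_inj => /(_ 0%N (i.+1 + j.+1)%N); rewrite leqnn addSn /= => /(_ isT).
rewrite /h leq0n subn0 ifF; last by lia.
by have -> : ((i + j.+1).+1 - i.+1 = j.+1)%N by lia.
Qed.

End Walks.

(** * Ends of a tree, their rays and cones *)

Section Ends.
Variables (T : choiceType) (e : rel T).
Hypothesis e_tree : is_tree e.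
Local Notation Omega := (boundary e).

(** Combinatorial form of the equivalence of paths defining an end; [infinite_meetP] matches it with
    sharing infinitely many vertices. *)
Definition merge (q q' : nat -> T) :=
  exists m n, forall k, q (m + k)%N = q' (n + k)%N.

Lemma merge_sym q q' : merge q q' -> merge q' q.
Proof. by move=> [m [n mn]]; exists n, m. Qed.

Lemma merge_trans q q' q'' : merge q q' -> merge q' q'' -> merge q q''.
Proof.
move=> [m [n mn]] [m' [n' mn']]; exists (m + m')%N, (n' + n)%N => k.
rewrite -addnA mn -addnA -mn'; congr q'; lia.
Qed.

Lemma infinite_range_meet (q q' : nat -> T) m n :
  infinite_set (range q `&` range q') ->
  exists i j, q (m + i)%N = q' (n + j)%N.
Proof.
move=> inf; apply: contrapT => none; apply: inf.
apply: (@sub_finite_set _ _ (q @` `I_m `|` q' @` `I_n)).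
  move=> _ [[i _ <-] [j _ q'j]].
  have [im|mi] := ltnP i m; first by left; exists i.
  have [jn|nj] := ltnP j n; first by right; exists j.
  by case: none; exists (i - m)%N, (j - n)%N; rewrite !subnKC.
by rewrite finite_setU; split; exact/finite_image/finite_II.
Qed.

(** A first common vertex aligns the two paths; common vertices arbitrarily far out then force
    agreement up to them by [nbpath_meet]. Conversely, a common tail is infinite because
    non-backtracking paths are injective. *)
Lemma infinite_meetP q q' : nbpath e q -> nbpath e q' ->
  infinite_set (range q `&` range q') <-> merge q q'.
Proof.
move=> nq nq'; split=> [inf|[m [n mn]]].
  have [m [n]] := infinite_range_meet 0 0 inf; rewrite !add0n => qmn.
  exists m, n => k.
  have [i [j]] := infinite_range_meet (m + k) n inf; rewrite -addnA => qij.
  have := @nbpath_meet _ _ e_tree _ _ (k + i)%N j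
    (nbpath_shift m nq) (nbpath_shift n nq').
  by rewrite !addn0 => /(_ qmn qij)[_]; apply; exact: leq_addr.
move=> fin; apply: infinite_nat.
have qI : {in [set: nat] &, injective (fun k => q (m + k)%N)}.
  by move=> i j _ _ /(nbpath_inj e_tree nq)/addnI.
rewrite -(eq_finite_set (inj_card_eq qI)).
by apply: sub_finite_set fin => _ [k _ <-]; split=> //; exists (n + k)%N.
Qed.

Lemma bd_valP (w : Omega) : exists2 q0, nbpath e q0 &
  forall q, val w q <-> nbpath e q /\ merge q0 q.
Proof.
case: w => w /= /[1!inE] -[q0 nq0 <-]; exists q0 => // q.
by split=> -[nq] /(infinite_meetP nq0 nq).
Qed.

Lemma bd_val_nbpath (w : Omega) q : val w q -> nbpath e q.
Proof. by have [q0 _ wE] := bd_valP w; move=> /wE[]. Qed.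

Lemma bd_val_merge (w : Omega) q q' : val w q -> val w q' -> merge q q'.
Proof.
have [q0 _ wE] := bd_valP w; move=> /wE[_ m1] /wE[_ m2].
exact: merge_trans (merge_sym m1) m2.
Qed.

Lemma merge_bd_val (w : Omega) q q' :
  val w q -> nbpath e q' -> merge q q' -> val w q'.
Proof.
have [q0 _ wE] := bd_valP w; move=> /wE[_ m1] nq' m2; apply/wE; split=> //.
exact: merge_trans m1 m2.
Qed.

Lemma bd_val_eq (w w' : Omega) q : val w q -> val w' q -> w = w'.
Proof.
move=> wq w'q; apply/val_inj/seteqP; split=> q' h.
  exact: merge_bd_val w'q (bd_val_nbpath h) (bd_val_merge wq h).
exact: merge_bd_val wq (bd_val_nbpath h) (bd_val_merge w'q h).
Qed.

Lemma nbpath_bd q : nbpath e q -> exists w : Omega, val w q.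
Proof.
move=> nq.
have Eq : end_class e q \in ends e by rewrite inE; exists q.
exists (Boundary Eq); split=> //; apply/infinite_meetP => //.
by exists 0%N, 0%N.
Qed.

(** If q steps onto x at once, its first vertex is dropped; otherwise x is put in front. *)
Lemma bd_val_cons (w : Omega) q x : val w q -> e x (q 0%N) ->
  exists2 q', val w q' & q' 0%N = x.
Proof.
move=> wq xq; have nq := bd_val_nbpath wq.
have [q1x|q1x] := pselect (q 1%N = x).
  exists (fun n => q (1 + n)%N) => //.
  apply: (merge_bd_val wq); first exact: nbpath_shift.
  by exists 1%N, 0%N => k.
exists (fun n => if n is m.+1 then q m else x) => //.
apply: (merge_bd_val wq); first exact: nbpath_cons.
by exists 0%N, 1%N => k.
Qed.

(** A representative is transported one edge at a time along a walk joining x to its origin. *)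
Lemma rayP x (w : Omega) : val w (ray x w) /\ ray x w 0%N = x.
Proof.
suff [q wq q0] : exists2 q, val w q & q 0%N = x.
  by rewrite /ray; case: xgetP => [? -> []//|/(_ q)[]].
have [q0 nq0 wE] := bd_valP w.
have [s] := tree_connected e_tree x (q0 0%N).
elim: s x => [|y s IH] x /= => [_ ->|/andP[xy ys] /(IH _ ys) [q wq qy]].
  by exists q0 => //; apply/wE; split=> //; exists 0%N, 0%N.
by apply: (bd_val_cons wq); rewrite qy.
Qed.

Lemma ray0 x (w : Omega) : ray x w 0%N = x.
Proof. by have [] := rayP x w. Qed.

Lemma ray_nbpath x (w : Omega) : nbpath e (ray x w).
Proof. by have [/bd_val_nbpath] := rayP x w. Qed.

Lemma ray_unique (w : Omega) q : val w q -> ray (q 0%N) w = q.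
Proof.
move=> wq; have [wr r0] := rayP (q 0%N) w; apply/funext => k.
have nr := bd_val_nbpath wr; have nq := bd_val_nbpath wq.
have [m [n mn]] := bd_val_merge wr wq.
have [_ ->//] := nbpath_meet e_tree nr nq r0 (mn k).
exact: leq_addl.
Qed.

Lemma ray_shift x (w : Omega) n k : ray (ray x w n) w k = ray x w (n + k)%N.
Proof.
have [wr r0] := rayP x w.
have /ray_unique : val w (fun k => ray x w (n + k)%N).
  apply: (merge_bd_val wr); first exact/nbpath_shift/ray_nbpath.
  by exists n, 0%N.
by rewrite addn0 => ->.
Qed.

Lemma edge_ray x (w : Omega) : e x (ray x w 1%N).
Proof. by have [+ _] := ray_nbpath x w 0%N; rewrite ray0. Qed.

(** A ray from y that does not begin with x can be prolonged backwards by x, which gives the ray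
    from x. *)
Lemma coneC x y (w : Omega) : e x y -> cone (x, y) w <-> ~ cone (y, x) w.
Proof.
move=> xy; rewrite /cone /=.
have nr := ray_nbpath y w.
split=> [xwy ywx|nywx].
  have := ray_shift y w 1 1; rewrite ywx xwy.
  by have [_] := nr 0%N; rewrite ray0 => /[swap] <-.
have /ray_unique/= -> // : val w (fun n => if n is m.+1 then ray y w m else x).
  apply: (merge_bd_val (rayP y w).1); last by exists 0%N, 1%N.
  by apply: nbpath_cons => //; rewrite ray0.
exact: ray0.
Qed.

Lemma cone_succ x y z : e x y -> z <> x ->
  cone (et := e) (y, z) `<=` cone (x, y).
Proof.
move=> xy zx w wyz; apply/coneC => // wyx; apply: zx.
by move: wyz wyx; rewrite /cone /= => <- <-.
Qed.

Lemma cone_ray_sub x (w : Omega) m n : (m <= n)%N ->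
  cone (ray x w n, ray x w n.+1) `<=` cone (et := e) (ray x w m, ray x w m.+1).
Proof.
elim: n => [|n IH]; first by rewrite leqn0 => /eqP ->.
rewrite leq_eqVlt => /predU1P[->//|/IH]; apply: subset_trans.
by have [? ?] := ray_nbpath x w n; exact: cone_succ.
Qed.

Lemma cone_ray x (w : Omega) n : cone (ray x w n, ray x w n.+1) w.
Proof. by rewrite /cone /= ray_shift addn1. Qed.

(** The ray from x eventually follows the ray from y, whose first cone contains all later ones. *)
Lemma cone_ray_eventually x y z (w : Omega) : cone (y, z) w ->
  exists n, forall n', (n <= n')%N ->
    cone (ray x w n', ray x w n'.+1) `<=` cone (et := e) (y, z).
Proof.
move=> wyz; have [m [n mn]] := bd_val_merge (rayP x w).1 (rayP y w).1.
exists m => n' mn'; have := mn (n' - m)%N; have := mn (n' - m).+1.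
rewrite !addnS subnKC // => -> ->.
have -> : (y, z) = (ray y w 0%N, ray y w 1%N) by rewrite ray0 wyz.
exact: cone_ray_sub.
Qed.

Lemma open_cone x y : e x y -> open (cone (et := e) (x, y)).
Proof.
move=> xy; exists [set cone (x, y)]; last by rewrite bigcup_set1.
by move=> _ ->; apply: (@finI_from1 _ _ _ id); exists (x, y).
Qed.

(** A basic open set is a finite intersection of cones. Each of them contains all sufficiently deep
    cones along the ray, and induction on the list takes the maximum of the depths. *)
Lemma nbhs_cone x (w : Omega) (A : set Omega) : nbhs w A ->
  exists n, cone (ray x w n, ray x w n.+1) `<=` A.
Proof.
rewrite nbhsE => -[U [[D' D'sub <-]] [B D'B Bw] UA].
suff [n nB] : exists n, forall n', (n <= n')%N ->
    cone (ray x w n', ray x w n'.+1) `<=` B.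
  by exists n; apply: subset_trans UA => w' /(nB _ (leqnn _)) Bw'; exists B.
have [F FD BE] := D'sub _ D'B; rewrite -BE in Bw *.
have {FD BE Bw D'B} Fw : forall C, C \in finmap.enum_fset F ->
    C w /\ exists2 a, e a.1 a.2 & C = cone a.
  move=> C CF; split; first exact: Bw.
  have := FD _ CF; rewrite inE => -[a ea <-]; exists a => //; exact: ea.
suff [n nP] : exists n, forall n', (n <= n')%N -> forall C,
    C \in finmap.enum_fset F ->
    cone (ray x w n', ray x w n'.+1) `<=` C.
  by exists n => n' nn' w' w'n' C CF; apply: nP nn' _ CF _ w'n'.
elim: (finmap.enum_fset F) Fw => [|C s IH] Fw; first by exists 0%N.
have [C' C's|n nP] := IH; first by apply: Fw; rewrite inE C's orbT.
have [|Cw [[y z] _ CE]] := Fw C; first by rewrite inE eqxx.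
rewrite CE in Cw; have [m mP] := cone_ray_eventually x Cw.
exists (maxn n m) => n' nn' C'; rewrite inE => /predU1P[->|C's].
  by rewrite CE; apply: mP; lia.
by apply: nP C's; lia.
Qed.

(** This criterion replaces the topology in the sequel: local constancy is tested on the cones along
    each ray, from any origin. *)
Lemma loc_constP (K : fieldType) (f : Omega -> K^o) :
  f \in @loc_const K T e <->
  (forall w x, exists n, forall w', cone (ray x w n, ray x w n.+1) w' -> f w' = f w).
Proof.
split=> [/asboolP lf w x|lf]; first exact: nbhs_cone (lf w).
apply/asboolP => w; have [q _ _] := bd_valP w.
have [n nf] := lf w (q 0%N).
apply: (filterS nf); apply: open_nbhs_nbhs; split; last exact: cone_ray.
by apply: open_cone; have [] := ray_nbpath (q 0%N) w n.
Qed.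

Lemma ray_act g x (w : Omega) : graph_aut e g ->
  ray (g x) (bd_act g w) = g \o ray x w.
Proof.
move=> ge; have [wr r0] := rayP x w.
have /ray_unique/= : val (bd_act g w) (g \o ray x w).
  by rewrite bd_actE //; exists (ray x w).
by rewrite r0.
Qed.

Lemma cone_act g x y (w : Omega) : graph_aut e g ->
  cone (g x, g y) (bd_act g w) <-> cone (x, y) w.
Proof.
move=> ge; rewrite /cone /= ray_act //=.
by split=> [|-> //]; case: ge => /bij_inj gI _ /gI.
Qed.

Lemma bd_actK g h : graph_aut e g -> graph_aut e h -> cancel g h ->
  cancel (@bd_act T e g) (bd_act h).
Proof.
move=> ge he gK w; have [q wq _] : exists2 q, val w q & nbpath e q.
  have [q nq wE] := bd_valP w; exists q => //; apply/wE; split=> //.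
  by exists 0%N, 0%N.
apply: (@bd_val_eq _ _ q) => //; rewrite !bd_actE //.
exists (g \o q); first by exists q.
by apply/funext => n /=; rewrite gK.
Qed.

(** * Locally constant functions on the boundary *)

Section Functions.
Variable K : fieldType.
Local Notation loc_const := (@loc_const K T e).

Definition cone_ind x y : Omega -> K^o := fun w => (ray x w 1%N == y)%:R.

Lemma cone_indT x y w : cone (x, y) w -> cone_ind x y w = 1.
Proof. by rewrite /cone_ind /cone /= => ->; rewrite eqxx. Qed.

Lemma cone_indF x y w : ~ cone (x, y) w -> cone_ind x y w = 0.
Proof. by rewrite /cone_ind /cone /=; case: eqP. Qed.

Lemma cone_ind_loc x y : e x y -> cone_ind x y \in loc_const.
Proof.
move=> xy; have yx : e y x by rewrite (tree_sym e_tree).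
apply/loc_constP => w v.
have [wxy|wxy] := pselect (cone (x, y) w).
  have [n /(_ n (leqnn _)) nP] := cone_ray_eventually v wxy.
  by exists n => w' /nP w'xy; rewrite !cone_indT.
have wyx : cone (y, x) w by apply/coneC.
have [n /(_ n (leqnn _)) nP] := cone_ray_eventually v wyx.
by exists n => w' /nP/(coneC _ yx) w'xy; rewrite !cone_indF.
Qed.

Lemma cst_loc_const (k : K) : (fun _ : Omega => k : K^o) \in loc_const.
Proof. by apply/loc_constP => w x; exists 0%N. Qed.

Lemma loc_constM (f f' : Omega -> K^o) : f \in loc_const -> f' \in loc_const ->
  (fun w => f w * f' w : K^o) \in loc_const.
Proof.
move=> /loc_constP lf /loc_constP lf'; apply/loc_constP => w x.
have [[n nP] [n' nP']] := (lf w x, lf' w x).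
exists (maxn n n') => w' w'w; rewrite nP ?nP' //.
  exact: cone_ray_sub (leq_maxr _ _) _ w'w.
exact: cone_ray_sub (leq_maxl _ _) _ w'w.
Qed.

Lemma loc_const_act (f : Omega -> K^o) g : graph_aut e g -> f \in loc_const ->
  f \o bd_act g \in loc_const.
Proof.
move=> ge /loc_constP lf; apply/loc_constP => w x.
have [n nP] := lf (bd_act g w) (g x).
exists n => w' w'w /=; apply: nP.
by rewrite ray_act //=; apply/cone_act.
Qed.

End Functions.

End Ends.

(** A continuation is chosen for every directed edge satisfying Q and then iterated. With trivial Q
    this shows that cones are non-empty; with Q the failure of subdivision it gives the ray of the
    Koenig argument. *)
Lemma exists_nbpath (T : eqType) (e : rel T) (Q : T -> T -> Prop) x y :
  (forall x y, e x y -> Q x y -> exists z, [/\ e y z, z <> x & Q y z]) ->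
  e x y -> Q x y ->
  exists q, [/\ nbpath e q, q 0%N = x, q 1%N = y &
                forall n, Q (q n) (q n.+1)].
Proof.
move=> ext exy Qxy.
have [f fP] : {f : T * T -> T & forall a, e a.1 a.2 -> Q a.1 a.2 ->
    [/\ e a.2 (f a), f a <> a.1 & Q a.2 (f a)]}.
  apply: (choice (P := fun a z => e a.1 a.2 -> Q a.1 a.2 ->
    [/\ e a.2 z, z <> a.1 & Q a.2 z])) => -[a b] /=.
  have [eab|] := boolP (e a b); last by exists a.
  have [Qab|] := pselect (Q a b); last by exists a.
  by have [z ?] := ext _ _ eab Qab; exists z.
pose s n := iter n (fun a => (a.2, f a)) (x, y).
have sP n : e (s n).1 (s n).2 /\ Q (s n).1 (s n).2.
  by elim: n => //= n [es Qs]; have [] := fP _ es Qs.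
exists (fun n => (s n).1); split=> // n; last by have [] := sP n.
split; first by have [] := sP n.
by have [es Qs] := sP n; have [] := fP _ es Qs.
Qed.

(** * Covering trees and deck transformations *)

Section Cover.
Variables (X : finType) (e : rel X) (Xt : choiceType) (et : rel Xt).
Variable p : Xt -> X.
Hypothesis cover : is_universal_cover e et p.

Lemma cover_tree : is_tree et.
Proof. by case: cover. Qed.

Lemma cover_surj x : exists y, p y = x.
Proof. by have [_ /(_ x I)[y _ <-] _] := cover; exists y. Qed.

Lemma cover_edge x y : et x y -> e (p x) (p y).
Proof. by have [_ _ /(_ x)[+ _ _]] := cover; apply. Qed.

Definition lift_at y c := xget y [set z | et y z /\ p z = c].

Lemma liftP y c : e (p y) c -> et y (lift_at y c) /\ p (lift_at y c) = c.
Proof.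
have [_ _ /(_ y)[_ _ surj]] := cover => /surj[z yz pz].
by rewrite /lift_at; case: xgetP => [? -> //|/(_ z)[]].
Qed.

Lemma lift_unique y z : et y z -> lift_at y (p z) = z.
Proof.
move=> yz; have [yl pl] := liftP (cover_edge yz).
have [_ _ /(_ y)[_ inj _]] := cover.
by apply: inj; rewrite ?inE.
Qed.

Lemma lift_neq x y c : et x y -> e (p y) c -> c != p x -> lift_at y c <> x.
Proof. by move=> xy yc /eqP cx lx; apply: cx; rewrite -lx; have [] := liftP yc. Qed.

Lemma lift_back x y : et x y -> lift_at y (p x) = x.
Proof. by move=> xy; apply: lift_unique; rewrite (tree_sym cover_tree). Qed.

(** Here s is a walk in the tree, possibly starting elsewhere: its projection is lifted again from
    y, and only the endpoint is kept. *)
Definition lift_walk y s := foldl lift_at y (map p s).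

(** The tail is reduced first. The new edge from x to v is then put in front, unless the reduced
    tail immediately returns to x, in which case the two opposite edges cancel; cancelling preserves
    lifts by [lift_back]. *)
Lemma walk_reduce x s : path et x s -> exists s',
  [/\ path et x s', nbwalk et (nth x (x :: s')) (size s'),
      last x s' = last x s & forall y, p y = p x -> lift_walk y s' = lift_walk y s].
Proof.
elim: s x => [|v s IH] x /=; first by exists [::]; split=> //; split=> -[].
move=> /andP[xv /IH[s' [vs' [_ nb] ls' Ls']]].
have Lv y : p y = p x -> et y (lift_at y (p v)) /\ p (lift_at y (p v)) = p v.
  by move=> yx; apply: liftP; rewrite yx; exact: cover_edge.
have walk z t : path et z t -> forall i, (i < size t)%N ->
    et (nth z (z :: t) i) (nth z (z :: t) i.+1).
  by move/(pathP z).
have [[t s'E]|ns'] := pselect (exists t, s' = x :: t).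
  move: vs' nb ls' Ls'; rewrite s'E /= => /andP[vx xt] nb ls' Ls'.
  exists t; split=> //; last first.
    move=> y yx; have [yl pl] := Lv _ yx.
    have := Ls' _ pl; rewrite /lift_walk /= => <-.
    by rewrite -yx (lift_back yl).
  split; first exact: (walk _ _ xt).
  move=> i it; have := nb i.+1; rewrite /= ltnS => /(_ it).
  by rewrite (set_nth_default x v) ?[nth v _ i](set_nth_default x) //=; lia.
exists (v :: s'); split=> //=; first by rewrite xv.
  split; first by apply: (walk _ (v :: s')); rewrite /= xv.
  case=> [|i] /=; rewrite ltnS => is'.
    case: s' ns' is' {nb ls' Ls' vs'} => // a s' ns' _ /= ax.
    by apply: ns'; exists s'; rewrite ax.
  have := nb i is'; rewrite /=.
  by rewrite (set_nth_default x v) ?[nth v _ i](set_nth_default x) //=; lia.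
by move=> y yx; rewrite /lift_walk /=; apply: Ls'; have [] := Lv _ yx.
Qed.

(* Reducing a walk does not change the endpoint of its lift, and a closed reduced
   walk in a tree is empty. *)
Lemma lift_closed_walk x y s : path et x s -> last x s = x -> p y = p x ->
  lift_walk y s = y.
Proof.
move=> xs lx yx; have [s' [_ nb ls' <-//]] := walk_reduce xs.
case: s' nb ls' => // z s' /(nbwalk_inj cover_tree) nb ls'.
case: (nb 0%N (size (z :: s'))); first by rewrite leqnn.
by rewrite [RHS](nth_last x (z :: s')) ls' lx.
Qed.

Lemma lift_walk_cat y s t : lift_walk y (s ++ t) = lift_walk (lift_walk y s) t.
Proof. by rewrite /lift_walk map_cat foldl_cat. Qed.

Lemma p_lift_walk x y s : path et x s -> p y = p x ->
  p (lift_walk y s) = p (last x s).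
Proof.
elim: s x y => [|z s IH] x y //= /andP[xz zs] yx; apply: IH => //.
by have [] := @liftP y (p z) ltac:(by rewrite yx; exact: cover_edge).
Qed.

(** With r a walk back from the common endpoint to x, both s ++ r and r ++ t are closed, so lifting
    s ++ r ++ t ends where s does and also where t does. *)
Lemma lift_walk_unique x y s t : path et x s -> path et x t ->
  last x s = last x t -> p y = p x -> lift_walk y s = lift_walk y t.
Proof.
move=> xs xt st yx.
have [r vr rx] := tree_connected cover_tree (last x s) x.
have E1 := @lift_closed_walk x y (s ++ r); have ys := p_lift_walk xs yx.
have E2 := @lift_closed_walk _ (lift_walk y s) (r ++ t) _ _ ys.
rewrite -[LHS]E2 ?cat_path ?last_cat ?vr ?rx //.
rewrite lift_walk_cat -[lift_walk (lift_walk y s) r]lift_walk_cat.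
by rewrite E1 ?cat_path ?last_cat ?xs.
Qed.

Definition cover_mor (g : Xt -> Xt) :=
  (forall x, p (g x) = p x) /\ (forall x y, et x y -> et (g x) (g y)).

(** The vertex v is sent to the endpoint of the lift from y of a chosen walk from x to v.
    Independence of the walk makes this compatible with edges. *)
Lemma exists_cover_mor x y : p y = p x -> exists2 g, cover_mor g & g x = y.
Proof.
move=> yx.
have [s sP] : {s : Xt -> seq Xt & forall v, path et x (s v) /\ last x (s v) = v}.
  apply: (choice (P := fun v s => path et x s /\ last x s = v)) => v.
  by have [s] := tree_connected cover_tree x v; exists s.
have sx := fun v => (sP v).1; have sl := fun v => (sP v).2.
exists (fun v => lift_walk y (s v)); last exact: (lift_closed_walk (sx x) (sl x)).
split=> [v|u v uv]; first by rewrite (p_lift_walk (sx v) yx) sl.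
have -> : lift_walk y (s v) = lift_at (lift_walk y (s u)) (p v).
  rewrite (@lift_walk_unique x y (s v) (rcons (s u) v)) ?last_rcons ?sl //.
    by rewrite /lift_walk map_rcons foldl_rcons.
  by rewrite rcons_path sx sl.
apply: (liftP _).1; rewrite (p_lift_walk (sx u) yx) sl.
exact: cover_edge.
Qed.

Lemma cover_mor_id g x : cover_mor g -> g x = x -> g =1 id.
Proof.
move=> [gp ge] gx.
apply: (connected_ind (x := x) (tree_connected cover_tree)) => // y z yz gy.
by rewrite -[RHS](lift_unique yz) -[LHS](@lift_unique y) ?gp // -{1}gy; exact: ge.
Qed.

(** Morphisms taking x to y and y to x exist; both composites fix a vertex, hence are the identity
    by [cover_mor_id]. *)
Lemma exists_deck x y : p y = p x -> exists2 g, deck et p g & g x = y.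
Proof.
move=> yx; have [g gM gx] := exists_cover_mor yx.
have [h hM hy] := exists_cover_mor (esym yx).
have comp_mor f f' : cover_mor f -> cover_mor f' -> cover_mor (f \o f').
  move=> [fp fe] [f'p f'e]; split=> [v|u v uv] /=; first by rewrite fp f'p.
  exact/fe/f'e.
have gK : cancel g h.
  by apply: (@cover_mor_id _ x (comp_mor _ _ hM gM)); rewrite /= gx.
have hK : cancel h g.
  by apply: (@cover_mor_id _ y (comp_mor _ _ gM hM)); rewrite /= hy.
exists g => //; split; last exact: gM.1.
split; first by exists h.
move=> u v; apply/idP/idP; last exact: gM.2.
by move/(hM.2); rewrite !gK.
Qed.

Lemma deck_p g x : deck et p g -> p (g x) = p x.
Proof. by case. Qed.

Lemma deck_aut g : deck et p g -> graph_aut et g.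
Proof. by case. Qed.

Lemma deck_lift g y c : deck et p g -> e (p y) c ->
  g (lift_at y c) = lift_at (g y) c.
Proof.
move=> [[_ ge] gp] yc; have [yl pl] := liftP yc.
by rewrite -(@lift_unique (g y) (g (lift_at y c))) ?ge // gp pl.
Qed.

Lemma deck_edge_transitive x y x' y' : et x y -> et x' y' ->
  p x = p x' -> p y = p y' -> exists g, [/\ deck et p g, g x = x' & g y = y'].
Proof.
move=> xy xy' px py; have [g gD gx] := exists_deck (esym px).
exists g; split=> //.
by rewrite -(lift_unique xy) deck_lift ?cover_edge // gx py lift_unique.
Qed.

End Cover.

(** * Distributions on the boundary *)

Section ConeIntegral.
Variables (X : finType) (e : rel X) (Xt : choiceType) (et : rel Xt).
Variable p : Xt -> X.
Hypothesis cover : is_universal_cover e et p.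
Hypothesis nde : no_dead_ends e.
Variable K : fieldType.
Local Notation Omega := (boundary et).
Local Notation loc_const := (@loc_const K Xt et).
Local Notation lift_at := (lift_at et p).
Local Notation tree := (cover_tree cover).

Lemma exists_succ x y : et x y -> exists2 z, et y z & z <> x.
Proof.
move=> xy; have [q nq [q0 q1]] := nde (cover_edge cover xy).
have [eq2 nq2] := (nq 1%N, nq 0%N); move: eq2 nq2; rewrite q0 q1 => -[yc _] [_ /eqP cx].
exists (lift_at y (q 2%N)); first exact: (liftP cover yc).1.
exact: lift_neq cover _ _ _ xy yc cx.
Qed.

Lemma cone_nonempty x y : et x y -> exists w : Omega, cone (x, y) w.
Proof.
move=> xy.
have [a b /exists_succ[c bc ca] _|q [nq q0 q1 _]] :=
  @exists_nbpath _ et (fun _ _ => Logic.True) x y _ xy I.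
  by exists c.
have [w wq] := nbpath_bd tree nq.
by exists w; rewrite /cone /= -q0 (ray_unique tree wq).
Qed.

(** The only surviving term is the one of the first step of the ray from x to w. *)
Lemma sum_cone_ind x (w : Omega) :
  \sum_(c | e (p x) c) cone_ind K x (lift_at x c) w = 1.
Proof.
have xr := edge_ray tree x w.
rewrite (bigD1 (p (ray x w 1%N))) ?(cover_edge cover) //=.
rewrite (lift_unique cover xr) cone_indT // big1 ?addr0 // => c /andP[xc /eqP cr].
by rewrite cone_indF // /cone /= => rc; apply: cr; rewrite rc (liftP cover xc).2.
Qed.

Lemma cone_indC x y (w : Omega) : et x y ->
  cone_ind K x y w + cone_ind K y x w = 1.
Proof.
move=> xy; have yx : et y x by rewrite (tree_sym tree).
have [wxy|wxy] := pselect (cone (x, y) w).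
  by rewrite cone_indT // cone_indF ?addr0 //; apply/(coneC tree w xy).
rewrite cone_indF // cone_indT ?add0r //.
by apply/(coneC tree w yx).
Qed.

(** The boundary is partitioned by the cones leaving y, and also by the cones of (x, y) and (y, x);
    the cone of (y, x) cancels. *)
Lemma cone_ind_succ x y (w : Omega) : et x y -> cone_ind K x y w =
  \sum_(c | e (p y) c && (c != p x)) cone_ind K y (lift_at y c) w.
Proof.
move=> xy; have := sum_cone_ind y w.
rewrite -(cone_indC w xy) (bigD1 (p x)) /=; last first.
  by apply: (cover_edge cover); rewrite (tree_sym tree).
by rewrite (lift_back cover xy) addrC => /addIr.
Qed.

Lemma sum_cone_integrand x (f : Omega -> K) (w : Omega) :
  f w = \sum_(c | e (p x) c) f w * cone_ind K x (lift_at x c) w.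
Proof. by rewrite -mulr_sumr sum_cone_ind mulr1. Qed.

Lemma loc_const_val_lin k (f g : loc_const_fun K et) :
  \val (k *: f + g) = k *: \val f + \val g :> (Omega -> K^o).
Proof. exact: linearP. Qed.

Section Distribution.
Variable mu : loc_const_fun K et -> K^o.
Hypothesis mu_lin : distribution mu.

(** Since [integral] passes through [insubd], linearity of mu reaches the integrands only once they
    are known to be locally constant. *)
Lemma integral_lin k (f g : Omega -> K) : f \in loc_const -> g \in loc_const ->
  integral mu (fun w => k * f w + g w) = k * integral mu f + integral mu g.
Proof.
move=> lf lg; rewrite /integral -mu_lin; congr mu; apply: val_inj.
have lfg : (fun w => k * f w + g w : K^o) \in loc_const.
  by move: (rpredD (rpredZ k lf) lg).
by rewrite loc_const_val_lin !insubdK.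
Qed.

Lemma cst0_loc_const : (fun=> 0 : K^o) \in loc_const.
Proof. exact: (cst_loc_const tree). Qed.

Lemma integral0 : integral mu (fun=> 0) = 0.
Proof.
have := integral_lin 1 cst0_loc_const cst0_loc_const.
rewrite (_ : (fun w => _) = fun=> 0); last by apply/funext => w; rewrite mul1r addr0.
by rewrite mul1r => /eqP; rewrite -subr_eq0 opprD addNKr oppr_eq0 => /eqP.
Qed.

Lemma integral_sum (P : pred X) (F : X -> Omega -> K) :
  (forall c, P c -> F c \in loc_const) ->
  integral mu (fun w => \sum_(c | P c) F c w) = \sum_(c | P c) integral mu (F c).
Proof.
(* Local constancy of the partial sums is carried along, because linearity needs it at every
   step. *)
move=> lF; suff [] : (fun w => \sum_(c | P c) F c w : K^o) \in loc_const /\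
  integral mu (fun w => \sum_(c | P c) F c w) = \sum_(c | P c) integral mu (F c) by [].
rewrite unlock /=; elim: (index_enum X) => [|c s [lI IH]] /=.
  by split; [exact: cst0_loc_const | exact: integral0].
case: ifP => Pc //; split; first by move: (rpredD (lF _ Pc) lI).
rewrite -IH -[integral mu (F c)]mul1r -integral_lin ?lF //.
by congr integral; apply/funext => w; rewrite mul1r.
Qed.

Lemma integralZ k (f : Omega -> K) : f \in loc_const ->
  integral mu (fun w => k * f w) = k * integral mu f.
Proof.
move=> lf; rewrite -[RHS]addr0 -integral0 -integral_lin ?cst0_loc_const //.
by congr integral; apply/funext => w; rewrite addr0.
Qed.

Definition edge_mass x y := integral mu (cone_ind K x y).

Lemma edge_mass_succ x y : et x y ->
  \sum_(c | e (p y) c && (c != p x)) edge_mass y (lift_at y c) = edge_mass x y.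
Proof.
move=> xy; rewrite -integral_sum => [|c /andP[yc _]]; last first.
  exact/(cone_ind_loc tree)/(liftP cover yc).1.
by congr integral; apply/funext => w; rewrite -cone_ind_succ.
Qed.

Lemma edge_mass_total x :
  \sum_(c | e (p x) c) edge_mass x (lift_at x c) = integral mu (fun=> 1).
Proof.
rewrite -integral_sum => [|c xc]; last exact/(cone_ind_loc tree)/(liftP cover xc).1.
by congr integral; apply/funext => w; exact: sum_cone_ind.
Qed.

End Distribution.

(* v is the integral of f over the cone of (x, y) for the measure that gives mass
   U (p a) (p b) to the cone of (a, b).  A relation, since the depth at which f
   becomes constant on all cones is not known beforehand. *)
Inductive cone_integral (U : X -> X -> K) (f : Omega -> K) : Xt -> Xt -> K -> Prop :=
| ConeCst x y k : (forall w, cone (x, y) w -> f w = k) ->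
    cone_integral U f x y (k * U (p x) (p y))
| ConeSum x y v :
    (forall c, e (p y) c -> c != p x -> cone_integral U f y (lift_at y c) (v c)) ->
    cone_integral U f x y (\sum_(c | e (p y) c && (c != p x)) v c).

(* Koenig's lemma: if the cone of (x, y) could not be subdivided finitely, neither
   could the cones along some ray, contradicting local constancy at its end. *)
Lemma exists_cone_integral U f x y : f \in loc_const -> et x y ->
  exists v, cone_integral U f x y v.
Proof.
move=> /(loc_constP tree) lf xy; apply: contrapT => none.
have [a b ab none'|q [nq q0 q1 qP]] := @exists_nbpath _ et
  (fun a b => ~ exists v, cone_integral U f a b v) x y _ xy none.
  apply: contrapT => all; apply: none'.
  have [v vP] : {v : X -> K & forall c, e (p b) c -> c != p a ->
      cone_integral U f b (lift_at b c) (v c)}.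
    apply: (choice (P := fun c v => e (p b) c -> c != p a ->
      cone_integral U f b (lift_at b c) v)) => c.
    have [bc|] := boolP (e (p b) c); last by exists 0.
    have [ca|] := boolP (c != p a); last by exists 0.
    have [[v vP]|nv] := pselect (exists v, cone_integral U f b (lift_at b c) v).
      by exists v.
    case: all; exists (lift_at b c); split=> //; first exact: (liftP cover bc).1.
    exact: (lift_neq cover ab).
  by exists (\sum_(c | e (p b) c && (c != p a)) v c); exact: ConeSum.
have [w wq] := nbpath_bd tree nq.
have [n nP] := lf w (q 0%N); rewrite (ray_unique tree wq) in nP.
by apply: (qP n); exists (f w * U (p (q n)) (p (q n.+1))); exact: ConeCst.
Qed.

(** Induction on the subdivision: at a leaf f is a constant times the cone indicator, at a node the
    indicator splits over the successors. *)
Lemma integral_cone mu U f x y v : distribution mu -> f \in loc_const ->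
  (forall x y, et x y -> edge_mass mu x y = U (p x) (p y)) ->
  cone_integral U f x y v -> et x y ->
  integral mu (fun w => f w * cone_ind K x y w) = v.
Proof.
move=> mu_lin lf muU; elim=> {x y v} [x y k fk|x y v _ IH] xy.
  rewrite -muU // -integralZ //; last exact: (cone_ind_loc tree).
  congr integral; apply/funext => w.
  have [/fk ->//|wxy] := pselect (cone (x, y) w).
  by rewrite cone_indF // !mulr0.
transitivity (\sum_(c | e (p y) c && (c != p x))
    integral mu (fun w => f w * cone_ind K y (lift_at y c) w)); last first.
  apply: eq_bigr => c /andP[yc cx]; apply: IH => //; exact: (liftP cover yc).1.
rewrite -integral_sum // => [|c /andP[yc _]].
  by congr integral; apply/funext => w; rewrite cone_ind_succ // mulr_sumr.
exact/(loc_constM tree)/(cone_ind_loc tree)/(liftP cover yc).1.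
Qed.

Lemma distribution_eq0 (mu : loc_const_fun K et -> K^o) : Xt -> distribution mu ->
  (forall x y, et x y -> edge_mass mu x y = 0) -> mu = 0.
Proof.
move=> o mu_lin mu0; apply/funext => f.
have lf := valP f.
transitivity (integral mu f); first by rewrite /integral valKd.
rewrite (_ : (f : Omega -> K) = fun w =>
    \sum_(c | e (p o) c) f w * cone_ind K o (lift_at o c) w); last first.
  by apply/funext => w; exact: sum_cone_integrand.
have loclift c : e (p o) c -> et o (lift_at o c) by case/(liftP cover).
rewrite integral_sum // => [|c oc]; last first.
  exact/(loc_constM tree)/(cone_ind_loc tree)/loclift.
rewrite big1 // => c oc.
(* For U = 0 every leaf contributes 0, hence so does every sum. *)
have [v vP] := exists_cone_integral (fun _ _ => 0) lf (loclift _ oc).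
rewrite (integral_cone mu_lin lf _ vP (loclift _ oc)) //.
elim: vP => [x y k _|x y u _ IH]; first by rewrite mulr0.
by rewrite big1 // => b /andP[yb bx]; exact: IH.
Qed.

End ConeIntegral.

(** * The invariant distribution attached to a solution of the edge equations *)

Section FlowMeasure.
Variables (X : finType) (e : rel X) (Xt : choiceType) (et : rel Xt).
Variable p : Xt -> X.
Hypothesis cover : is_universal_cover e et p.
Hypothesis nde : no_dead_ends e.
Variables (K : fieldType) (o : Xt).
Local Notation Omega := (boundary et).
Local Notation loc_const := (@loc_const K Xt et).
Local Notation lift := (lift_at et p).
Local Notation tree := (cover_tree cover).

Lemma integral_act (mu : loc_const_fun K et -> K^o) g (f : Omega -> K) :
  inv_distribution et p o 1 mu -> deck et p g -> f \in loc_const ->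
  integral mu (f \o bd_act g) = integral mu f.
Proof.
move=> [_ /(_ g) muE] gD lf; rewrite -[RHS](congr1 (@^~ _) (muE gD)).
congr integral; apply/funext => w /=; rewrite exp1rz mul1r.
by rewrite -[loc_const_val _]/(\val _) insubdK.
Qed.

Lemma edge_mass_deck (mu : loc_const_fun K et -> K^o) x y x' y' :
  inv_distribution et p o 1 mu -> et x y -> et x' y' ->
  p x = p x' -> p y = p y' -> edge_mass mu x' y' = edge_mass mu x y.
Proof.
move=> mu_inv xy xy' px py.
have [g [gD <- <-]] := deck_edge_transitive cover xy xy' px py.
have gxy : et (g x) (g y) by rewrite (deck_aut gD).2.
rewrite /edge_mass -(integral_act mu_inv gD) ?(cone_ind_loc tree) //.
congr integral; apply/funext => w /=.
rewrite /cone_ind (ray_act tree) ?deck_aut //=; last exact: deck_aut gD.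
by rewrite (inj_eq (bij_inj (deck_aut gD).1)).
Qed.

Variable U : X -> X -> K.
Hypothesis U_succ : forall x y, e x y ->
  \sum_(c | e y c && (c != x)) U y c = U x y.
Local Notation CI := (@cone_integral X e Xt et p K U).

(** At a leaf the two constants agree because the cone is non-empty; at a node the masses add up by
    [U_succ]. *)
Lemma cone_integral_cst f x y k v : CI f x y v -> et x y ->
  (forall w, cone (x, y) w -> f w = k) -> v = k * U (p x) (p y).
Proof.
elim=> {x y v} [x y k' fk'|x y v _ IH] xy fk.
  by have [w wxy] := cone_nonempty cover nde xy; rewrite -(fk' _ wxy) (fk _ wxy).
rewrite -U_succ ?(cover_edge cover) // mulr_sumr; apply: eq_bigr => c /andP[yc cx].
have [yl pl] := liftP cover yc.
rewrite (IH c) ?pl // => w wyc; apply: fk.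
exact: (cone_succ tree xy (lift_neq cover xy yc cx) wyc).
Qed.

(** A leaf may be subdivided once more without changing its value, again by [U_succ]. *)
Lemma cone_integral_inv f x y v : CI f x y v -> et x y ->
  exists2 v', v = \sum_(c | e (p y) c && (c != p x)) v' c &
    forall c, e (p y) c -> c != p x -> CI f y (lift y c) (v' c).
Proof.
case=> {x y v} [x y k fk|x y v vP] xy; last by exists v.
exists (fun c => k * U (p y) c).
  by rewrite -mulr_sumr U_succ ?(cover_edge cover).
move=> c yc cx; have [yl {2}<-] := liftP cover yc.
apply: ConeCst => w wyc; apply: fk.
exact: (cone_succ tree xy (lift_neq cover xy yc cx) wyc).
Qed.

Lemma cone_integral_lin_cst a k f g x y v : CI g x y v -> et x y ->
  (forall w, cone (x, y) w -> f w = k) ->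
  CI (fun w => a * f w + g w) x y (a * (k * U (p x) (p y)) + v).
Proof.
elim=> {x y v} [x y k' gk'|x y v _ IH] xy fk.
  rewrite mulrA -mulrDl; apply: ConeCst => w wxy.
  by rewrite fk // gk'.
rewrite -U_succ ?(cover_edge cover) // !mulr_sumr -big_split /=.
apply: ConeSum => c yc cx; have [yl pl] := liftP cover yc.
rewrite -[in U _ c]pl; apply: IH => // w wyc; apply: fk.
exact: (cone_succ tree xy (lift_neq cover xy yc cx) wyc).
Qed.

(** Induction on the subdivision for f; where it branches, the one for g is made to branch too by
    [cone_integral_inv]. *)
Lemma cone_integral_lin a f g x y v v' : CI f x y v -> et x y -> CI g x y v' ->
  CI (fun w => a * f w + g w) x y (a * v + v').
Proof.
move=> fv; elim: fv v' => {x y v} [x y k fk|x y v _ IH] v' xy gv'.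
  exact: cone_integral_lin_cst.
have [u -> uP] := cone_integral_inv gv' xy.
rewrite mulr_sumr -big_split; apply: ConeSum => c yc cx.
by apply: IH => //; [exact: (liftP cover yc).1 | exact: uP].
Qed.

(** By linearity v' - v is a cone integral of the zero function. *)
Lemma cone_integral_unique f x y v v' : et x y ->
  CI f x y v -> CI f x y v' -> v = v'.
Proof.
move=> xy fv fv'; have := cone_integral_lin (-1) fv xy fv'.
move/cone_integral_cst => /(_ 0 xy); rewrite mul0r mulN1r => E.
by apply/esym/eqP; rewrite -subr_eq0 addrC E // => w _; rewrite mulN1r addNr.
Qed.

Definition cone_mass f x y := xget 0 [set v | CI f x y v].

Lemma cone_massP (f : Omega -> K) x y :
  f \in loc_const -> et x y -> CI f x y (cone_mass f x y).
Proof.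
move=> lf xy; have [v fv] := exists_cone_integral cover U lf xy.
by rewrite /cone_mass; case: xgetP => [? -> //|/(_ v)].
Qed.

Lemma cone_mass_eq f x y v : et x y -> CI f x y v -> cone_mass f x y = v.
Proof.
move=> xy fv; apply: (cone_integral_unique xy _ fv).
by rewrite /cone_mass; case: xgetP => [? -> //|/(_ v)].
Qed.

Lemma cone_mass_succ (f : Omega -> K) x y : f \in loc_const -> et x y ->
  \sum_(c | e (p y) c && (c != p x)) cone_mass f y (lift y c) = cone_mass f x y.
Proof.
move=> lf xy; apply/esym/cone_mass_eq => //; apply: ConeSum => c yc _.
exact/cone_massP/(liftP cover yc).1.
Qed.

Definition total_mass f x := \sum_(c | e (p x) c) cone_mass f x (lift x c).

(* The right-hand side is symmetric in x and y, so the total mass does not depend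
   on the vertex from which it is computed. *)
Lemma total_mass_edge (f : Omega -> K) x y : f \in loc_const -> et x y ->
  total_mass f x = cone_mass f x y + cone_mass f y x.
Proof.
move=> lf xy; rewrite /total_mass (bigD1 (p y)) ?(cover_edge cover) //=.
rewrite (lift_unique cover xy) -(@cone_mass_succ f y x) //.
by rewrite (tree_sym tree).
Qed.

Lemma total_massE (f : Omega -> K) x y : f \in loc_const ->
  total_mass f x = total_mass f y.
Proof.
move=> lf; apply: (connected_ind (tree_connected tree) (x := x)
  (P := fun y => total_mass f x = total_mass f y)) => // a b ab ->.
by rewrite (total_mass_edge lf ab) addrC -total_mass_edge // (tree_sym tree).
Qed.

(** The subdivision is carried along by g, since U sees only projections. The inverse h pulls ends
    of the translated cone back to the original one. *)
Lemma cone_integral_deck g f x y v : deck et p g -> et x y ->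
  CI (f \o bd_act g) x y v -> CI f (g x) (g y) v.
Proof.
move=> gD + fv; have gA := deck_aut gD; have [[h gK hK] ge] := gA.
have hA : graph_aut et h.
  by split; [exists g | move=> a b; rewrite -ge !hK].
elim: fv => {x y v} [x y k fk|x y v _ IH] xy.
  rewrite -(deck_p x gD) -(deck_p y gD); apply: ConeCst => w.
  have wK : bd_act g (bd_act h w) = w by rewrite (bd_actK tree).
  by rewrite -{1}wK => /(cone_act tree)-/(_ gA)/fk /=; rewrite wK.
rewrite -(deck_p x gD) -(deck_p y gD); apply: ConeSum => c.
rewrite !(deck_p _ gD) => yc cx; rewrite -(deck_lift cover gD yc).
by apply: IH => //; exact: (liftP cover yc).1.
Qed.

Lemma total_mass_deck g (f : Omega -> K) x : f \in loc_const -> deck et p g ->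
  total_mass (f \o bd_act g) x = total_mass f (g x).
Proof.
move=> lf gD; rewrite /total_mass (deck_p x gD); apply: eq_bigr => c xc.
have [xl _] := liftP cover xc.
rewrite -(deck_lift cover gD xc); apply/esym/cone_mass_eq.
  by rewrite (deck_aut gD).2.
apply: cone_integral_deck => //; apply: cone_massP => //.
exact: (loc_const_act tree (deck_aut gD) lf).
Qed.

Definition flow_measure (F : loc_const_fun K et) : K^o := total_mass F o.

Lemma flow_measure_distribution : distribution flow_measure.
Proof.
move=> k f g; rewrite /flow_measure /total_mass mulr_sumr -big_split /=.
apply: eq_bigr => c oc; have [ol _] := liftP cover oc.
apply: cone_mass_eq => //.
rewrite [X in CI X](_ : _ = (fun w => k * f w + g w)); last first.
  exact: (loc_const_val_lin k f g).
by apply: cone_integral_lin => //; apply: cone_massP => //; exact: valP.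
Qed.

Lemma integral_flow_measure (f : Omega -> K) x : f \in loc_const ->
  integral flow_measure f = total_mass f x.
Proof.
move=> lf; rewrite (total_massE x o lf) /integral /flow_measure.
by rewrite -[loc_const_val _]/(\val _) insubdK.
Qed.

Lemma flow_measure_inv : inv_distribution et p o 1 flow_measure.
Proof.
split=> [|g gD]; first exact: flow_measure_distribution.
apply/funext => f; rewrite /twisted_action; have lf := valP f.
rewrite (_ : (fun w => _) = f \o bd_act g); last first.
  by apply/funext => w; rewrite exp1rz mul1r.
rewrite (integral_flow_measure o) ?(loc_const_act tree (deck_aut gD)) //.
by rewrite total_mass_deck // (total_massE _ o).
Qed.

(** Computed from x, the total mass splits over the cones of (x, y) and (y, x), on which the
    indicator is constantly 1 and 0. *)
Lemma flow_measure_edge_mass x y : et x y ->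
  edge_mass flow_measure x y = U (p x) (p y).
Proof.
move=> xy; have yx : et y x by rewrite (tree_sym tree).
have lxy := cone_ind_loc tree K xy.
rewrite /edge_mass (integral_flow_measure x) // (total_mass_edge lxy xy).
rewrite (cone_integral_cst (cone_massP lxy xy) xy (k := 1)); last first.
  by move=> w; exact: cone_indT.
rewrite (cone_integral_cst (cone_massP lxy yx) yx (k := 0)); last first.
  by move=> w /(coneC tree _ yx); exact: cone_indF.
by rewrite mul1r mul0r addr0.
Qed.

End FlowMeasure.

(** * Transfer of dimensions and kernels of matrices *)

Lemma has_dim_transfer (K : fieldType) (V W : lmodType K) (S : set V)
    (S' : set W) (f : {linear V -> W}) d :
  S 0 -> (forall a u v, S u -> S v -> S (a *: u + v)) ->
  (forall v, S v -> S' (f v)) -> (forall w, S' w -> exists2 v, S v & f v = w) ->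
  (forall v, S v -> f v = 0 -> v = 0) -> has_dim S' d -> has_dim S d.
Proof.
move=> S0 SD SS' surj inj [n [b [dn free span]]].
have bS' i : S' (b i).
  apply/span; exists (fun j => (j == i)%:R).
  by rewrite (bigD1 i) //= eqxx scale1r big1 ?addr0 // => j /negPf ->; rewrite scale0r.
(* The basis of S consists of chosen preimages of the basis of S'; injectivity of f on S is what
   makes it span. *)
have [g gP] := choice (P := fun i v => S v /\ f v = b i)
  (fun i => let: ex_intro2 v Sv fv := surj _ (bS' i) in ex_intro _ v (conj Sv fv)).
have Scomb (c : 'I_n -> K) : S (\sum_i c i *: g i).
  apply: (big_ind S) => [//|u v Su Sv|i _]; first by rewrite -[u]scale1r; exact: SD.
  by rewrite -[_ *: _]addr0; apply: SD => //; exact: (gP i).1.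
have fcomb (c : 'I_n -> K) : f (\sum_i c i *: g i) = \sum_i c i *: b i.
  by rewrite linear_sum; apply: eq_bigr => i _; rewrite linearZ /= (gP i).2.
exists n, g; split=> // [c c0|v]; first by apply: free; rewrite -fcomb c0 linear0.
split=> [Sv|[c ->]]; last exact: Scomb.
have /span[c vc] := SS' _ Sv.
exists c; apply/eqP; rewrite -subr_eq0; apply/eqP/inj.
  rewrite addrC -scaleN1r; exact: SD.
by rewrite linearB /= fcomb vc subrr.
Qed.

Lemma has_dim_kermx (K : fieldType) m n (A : 'M[K]_(m, n)) :
  has_dim [set u : 'rV[K]_m | u *m A = 0] (\rank (kermx A))%:Z.
Proof.
pose B := row_base (kermx A).
have combE (c : 'I_(\rank (kermx A)) -> K) :
    \sum_i c i *: row i B = (\row_i c i) *m B.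
  by rewrite mulmx_sum_row; apply: eq_bigr => i _; rewrite mxE.
exists (\rank (kermx A)), (fun i => row i B); split=> // [c|v].
  rewrite combE => /eqP; rewrite mulmx_free_eq0 ?row_base_free // => /eqP/rowP c0 i.
  by have := c0 i; rewrite !mxE.
rewrite /mkset; split=> [/sub_kermxP|[c ->]].
  rewrite -(eq_row_base (kermx A)) => /submxP[D ->].
  exists (D 0); rewrite combE; congr (_ *m _).
  by apply/rowP => i; rewrite mxE.
by rewrite combE; apply/sub_kermxP; rewrite -(eq_row_base (kermx A)) submxMl.
Qed.

(** * The linear system of flows *)

Section Orientation.
Variables (X : finType) (e : rel X).
Hypothesis e_graph : is_graph e.

(** The enumeration of the vertices serves to select one direction of each edge. *)
Definition oriented (x y : X) := e x y && (enum_rank x < enum_rank y)%N.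

Definition arcs : {set X * X} := [set a | oriented a.1 a.2]%SET.

Lemma orientedN x y : e x y -> oriented y x = ~~ oriented x y.
Proof.
case: e_graph => es ei xy; rewrite /oriented es xy /= -leqNgt.
rewrite ltn_neqAle; case: eqP => //= rk; have yx := enum_rank_inj (ord_inj rk).
by move: xy; rewrite yx ei.
Qed.

Lemma oriented_edge x y : oriented x y -> e x y.
Proof. by case/andP. Qed.

Lemma card_arcs : #|arcs| = num_edges e.
Proof.
case: e_graph => es ei.
pose pr (a : X * X) := [set a.1; a.2]%SET.
have prI : {in arcs &, injective pr}.
  move=> [x y] [x' y']; rewrite !inE /= => /andP[_ xy] /andP[_ xy'] /setP E.
  have := E x; have := E y; rewrite !inE !eqxx /= orbT.
  move=> /esym/orP[]/eqP yE /esym/orP[]/eqP xE; subst.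
  - by rewrite ltnn in xy.
  - by move: (ltn_trans xy xy'); rewrite ltnn.
  - by [].
  - by rewrite ltnn in xy.
rewrite -(card_in_imset prI); congr (#|pred_of_set _|); apply/setP => A.
apply/imsetP/imsetP => -[[x y]]; rewrite !inE /= => xy ->.
  by exists (x, y); rewrite ?inE ?(oriented_edge xy).
have [oxy|] := boolP (oriented x y); first by exists (x, y); rewrite ?inE.
rewrite -(orientedN xy) => oyx; exists (y, x); rewrite ?inE //.
exact: finset.setUC.
Qed.

Lemma sum_arcs (V : nmodType) (F : X -> X -> V) :
  \sum_(a in arcs) F a.1 a.2 = \sum_x \sum_(y | oriented x y) F x y.
Proof.
by rewrite pair_big_dep /=; apply: eq_bigl => -[x y]; rewrite inE.
Qed.

Lemma sum_arcs_op (V : nmodType) (F : X -> X -> V) :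
  \sum_(a in arcs) F a.2 a.1 = \sum_x \sum_(y | oriented y x) F x y.
Proof. by rewrite (sum_arcs (fun x y => F y x)) (exchange_big_dep predT). Qed.

Lemma sum_edges_split (V : nmodType) (F : X -> V) x :
  \sum_(y | e x y) F y =
  \sum_(y | oriented x y) F y + \sum_(y | oriented y x) F y.
Proof.
rewrite (bigID (fun y => oriented x y)) /=; congr (_ + _); apply: eq_bigl => y.
  by rewrite andb_idl //; exact: oriented_edge.
apply/andP/idP => [[xy]|oyx]; first by rewrite (orientedN xy).
have xy : e x y by case: e_graph => -> _; exact: oriented_edge oyx.
by split=> //; rewrite -(orientedN xy).
Qed.

Lemma sum_degrees (V : nmodType) (F : X -> X -> V) :
  \sum_x \sum_(y | e x y) F x y = \sum_(a in arcs) (F a.1 a.2 + F a.2 a.1).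
Proof.
rewrite big_split /= sum_arcs sum_arcs_op -big_split /=.
by apply: eq_bigr => x _; exact: sum_edges_split.
Qed.

End Orientation.

(** * Flow equations and the rank of their matrix *)

Section Flows.
Variables (X : finType) (e : rel X).
Hypotheses (e_graph : is_graph e) (e_conn : connected_graph e).
Variable K : numFieldType.

Definition is_flow (U : X -> X -> K) (C : K) :=
  (forall x, \sum_(y | e x y) U x y = C) /\
  (forall x y, e x y -> U x y + U y x = C).

Lemma flow_succ U C : is_flow U C -> forall x y, e x y ->
  \sum_(c | e y c && (c != x)) U y c = U x y.
Proof.
move=> [div anti] x y xy; have yx : e y x by case: e_graph => ->.
by have := div y; rewrite (bigD1 x) //= -(anti _ _ yx) => /addrI.
Qed.

(** The sum of U over the edges leaving x equals U x y + U y x for each neighbour y. This is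
    symmetric in x and y, so connectedness makes it constant. *)
Lemma succ_flow U : (forall x y, e x y ->
    \sum_(c | e y c && (c != x)) U y c = U x y) ->
  forall x0, is_flow U (\sum_(y | e x0 y) U x0 y).
Proof.
move=> Us x0.
have E x y : e x y -> \sum_(c | e y c) U y c = U x y + U y x.
  move=> xy; have yx : e y x by case: e_graph => ->.
  by rewrite (bigD1 x) //= Us // addrC.
have Sconst x : \sum_(y | e x y) U x y = \sum_(y | e x0 y) U x0 y.
  apply: (connected_ind e_conn (x := x0)
    (P := fun x => \sum_(y | e x y) U x y = \sum_(y | e x0 y) U x0 y)) => // y z yz <-.
  by rewrite (E _ _ yz) addrC -E //; case: e_graph => ->.
by split=> // x y xy; rewrite -(Sconst y) (E _ _ xy).
Qed.

(** The sum of U over all directed edges is computed by vertices and by pairs of opposite edges. *)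
Lemma flow_massE U C : is_flow U C -> #|X|%:R * C = #|arcs e|%:R * C.
Proof.
move=> [div anti]; transitivity (\sum_x \sum_(y | e x y) U x y).
  by rewrite (eq_bigr (fun=> C)) // sumr_const mulr_natl.
rewrite sum_degrees // (eq_bigr (fun=> C)) ?sumr_const ?mulr_natl // => a.
by rewrite inE => /oriented_edge/anti.
Qed.

Definition extend (u : dedge e -> K) (x y : X) : K := oapp u 0 (insub (x, y)).

Lemma extend_val u (a : dedge e) : extend u (val a).1 (val a).2 = u a.
Proof. by rewrite /extend -surjective_pairing valK. Qed.

Lemma extend_restrict (U : X -> X -> K) x y : e x y ->
  extend (fun a => U (val a).1 (val a).2) x y = U x y.
Proof. by move=> xy; rewrite /extend insubT. Qed.

Lemma edge_laplacianE (u : dedge e -> K) a : edge_laplacian u a =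
  \sum_(c | e (val a).2 c && (c != (val a).1)) extend u (val a).2 c.
Proof.
case: a => -[x y] xy /=; rewrite /edge_laplacian /=.
rewrite (partition_big (fun b : dedge e => (val b).2)
  (fun c => e y c && (c != x))) /=; last first.
  by move=> [[y' c] /= yc] /andP[/eqP <-]; rewrite xpair_eqE eqxx /= yc.
apply: eq_bigr => c /andP[yc cx].
rewrite /extend insubT /=; apply: big_pred1 => -[[y' c'] y'c'] /=.
rewrite -val_eqE /= !xpair_eqE /=.
case: (eqVneq c' c) => [->|_]; last by rewrite !andbF.
by rewrite (negPf cx) andbF !andbT.
Qed.

Lemma edge_eigenspace_succ (u : dedge e -> K^o) : edge_eigenspace e 1 u <->
  forall x y, e x y ->
    \sum_(c | e y c && (c != x)) extend u y c = extend u x y.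
Proof.
split=> [Eu x y xy|Eu a].
  pose a : dedge e := exist _ (x, y) xy.
  by have := Eu a; rewrite edge_laplacianE mul1r -(extend_val u a).
by rewrite edge_laplacianE mul1r Eu ?extend_val //; exact: (valP a).
Qed.

Lemma restrict_flow (U : X -> X -> K) C : is_flow U C ->
  edge_eigenspace e 1 (fun a => U (val a).1 (val a).2).
Proof.
move=> /flow_succ Us; apply/edge_eigenspace_succ => x y xy.
rewrite extend_restrict // -Us //; apply: eq_bigr => c /andP[yc _].
by rewrite extend_restrict.
Qed.

Lemma extend_lin k (u v : dedge e -> K^o) x y :
  extend (k *: u + v) x y = k * extend u x y + extend v x y.
Proof.
by rewrite /extend; case: insub => //=; rewrite mulr0 addr0.
Qed.

Definition flow_coords (U : X -> X -> K) (C : K) : 'rV[K]_(#|arcs e| + 1) :=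
  row_mx (\row_i U (enum_val i).1 (enum_val i).2) C%:M.

(* The unknowns are the values of a flow on the arcs and its constant C, the values
   on the reversed arcs being C - U; the column of a vertex x is the equation
   [\sum_(y | e x y) U x y - C = 0]. *)
Definition flow_mx : 'M[K]_(#|arcs e| + 1, #|X|) :=
  col_mx (\matrix_(i, j) ((enum_val j == (enum_val i).1)%:R
                        - (enum_val j == (enum_val i).2)%:R))
         (\row_j (\sum_(y | oriented e y (enum_val j)) 1 - 1)).

Lemma sum_delta (P : rel X) (G : X -> X -> K) x :
  \sum_a \sum_(b | P a b) G a b * (x == a)%:R = \sum_(b | P x b) G x b.
Proof.
rewrite (bigD1 x) //= [X in _ + X]big1 ?addr0 => [|a /negPf ax].
  by apply: eq_bigr => b _; rewrite eqxx mulr1.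
by rewrite big1 // => b _; rewrite eq_sym ax mulr0.
Qed.

Lemma flow_coords_mul U C j (x := enum_val j) :
  (flow_coords U C *m flow_mx) 0 j =
  \sum_(y | oriented e x y) U x y + \sum_(y | oriented e y x) (C - U y x) - C.
Proof.
rewrite mul_row_col mul_scalar_mx !mxE -/x.
under eq_bigr do rewrite !mxE -/x.
rewrite -(big_enum_val (A := mem (arcs e)) (fun a => U a.1 a.2 *
  ((x == a.1)%:R - (x == a.2)%:R))) /=.
under eq_bigr do rewrite mulrBr.
rewrite sumrB (sum_arcs _ (fun a b => U a b * (x == a)%:R)) sum_delta.
rewrite (sum_arcs_op _ (fun a b => U b a * (x == a)%:R)).
rewrite (sum_delta (fun a b => oriented e b a)).
rewrite sumrB -[in RHS](mulr1 C) -mulr_sumr mulrBr; ring.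
Qed.

Lemma flow_coords_ker U C : is_flow U C -> flow_coords U C *m flow_mx = 0.
Proof.
move=> [div anti]; apply/rowP => j; rewrite flow_coords_mul mxE.
rewrite -[X in _ - X](div (enum_val j)) (sum_edges_split e_graph).
apply/eqP; rewrite subr_eq0; apply/eqP; congr (_ + _).
by apply: eq_bigr => y /oriented_edge yx; rewrite -(anti _ _ yx) addrC addKr.
Qed.

Definition coords_flow (U : X -> X -> K) (C : K) x y :=
  if oriented e x y then U x y else C - U y x.

Lemma ker_coords_flow U C : flow_coords U C *m flow_mx = 0 ->
  is_flow (coords_flow U C) C.
Proof.
move=> UC0; split=> [x|x y xy].
  have /eqP := congr1 (fun A : 'rV__ => A 0 (enum_rank x)) UC0.
  rewrite flow_coords_mul enum_rankK mxE subr_eq0 => /eqP sumC; rewrite -[RHS]sumC.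
  rewrite (sum_edges_split e_graph); congr (_ + _); apply: eq_bigr => y oy.
    by rewrite /coords_flow oy.
  by rewrite /coords_flow (orientedN e_graph (oriented_edge oy)) oy.
rewrite /coords_flow (orientedN e_graph xy).
by case: oriented => /=; rewrite ?subrK // addrC subrK.
Qed.

Lemma mul_flow_mxT_l (w : 'rV[K]_#|X|) i :
  (w *m flow_mx^T) 0 (lshift 1 i) =
  w 0 (enum_rank (enum_val i).1) - w 0 (enum_rank (enum_val i).2).
Proof.
rewrite mxE; under eq_bigr do rewrite mxE /flow_mx col_mxEu !mxE mulrBr.
rewrite sumrB; congr (_ - _).
  rewrite (bigD1 (enum_rank (enum_val i).1)) //= enum_rankK eqxx mulr1.
  rewrite big1 ?addr0 // => j jx; case: eqP => [jE|_]; last by rewrite mulr0.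
  by rewrite -jE enum_valK eqxx in jx.
rewrite (bigD1 (enum_rank (enum_val i).2)) //= enum_rankK eqxx mulr1.
rewrite big1 ?addr0 // => j jx; case: eqP => [jE|_]; last by rewrite mulr0.
by rewrite -jE enum_valK eqxx in jx.
Qed.

Lemma mul_flow_mxT_r k :
  ((const_mx k : 'rV[K]_#|X|) *m flow_mx^T) 0 (rshift _ 0) =
  k * (#|arcs e|%:R - #|X|%:R).
Proof.
rewrite mxE; under eq_bigr do rewrite mxE [flow_mx^T _ _]mxE /flow_mx col_mxEd mxE.
rewrite -mulr_sumr; congr (_ * _).
rewrite -(big_enum_val (A := mem X) (fun x => \sum_(y | oriented e y x) 1 - 1)) /=.
by rewrite sumrB sumr_const -(sum_arcs_op _ (fun _ _ => 1)) sumr_const.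
Qed.

(** The arc entries of the product are differences of w along arcs, so w is constant by
    connectedness; the last entry gives the condition on the constant. *)
Lemma flow_mx_left_ker (w : 'rV[K]_#|X|) : X ->
  w *m flow_mx^T = 0 <->
  exists2 k, w = const_mx k & k * (#|arcs e|%:R - #|X|%:R) = 0.
Proof.
move=> x0; split=> [w0|[k -> k0]]; last first.
  apply/rowP => i; rewrite [RHS]mxE.
  case: (split_ordP i) => {}i ->; first by rewrite mul_flow_mxT_l !mxE subrr.
  by rewrite (ord1 i) mul_flow_mxT_r.
suff wE : w = const_mx (w 0 (enum_rank x0)).
  by exists (w 0 (enum_rank x0)); rewrite // -mul_flow_mxT_r -wE w0 mxE.
apply/rowP => i; rewrite mxE -(enum_valK i).
apply: (connected_ind e_conn (x := x0)
  (P := fun x => w 0 (enum_rank x) = w 0 (enum_rank x0))) => // x y xy <-.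
have arc a b : oriented e a b -> w 0 (enum_rank a) = w 0 (enum_rank b).
  move=> ab; have abA : (a, b) \in arcs e by rewrite inE.
  apply/eqP; rewrite -subr_eq0.
  have := mul_flow_mxT_l w (enum_rank_in abA (a, b)).
  by rewrite enum_rankK_in //= => <-; rewrite w0 mxE.
have := orientedN e_graph xy.
by case: (boolP (oriented e x y)) => [/arc -> //|_] /arc.
Qed.

(** The boolean is read as 0 or 1. The kernel is the line of constants when the two cardinals agree;
    otherwise their difference is invertible in characteristic zero and the kernel vanishes. *)
Lemma rank_flow_mx_left_ker : X ->
  \rank (kermx flow_mx^T) = (#|arcs e| == #|X|).
Proof.
move=> x0; case: eqVneq => /= [E|NE]; last first.
  apply/eqP; rewrite mxrank_eq0 -submx0; apply/row_subP => i.
  have /sub_kermxP/(flow_mx_left_ker _ x0)[k -> /eqP] :=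
    row_sub i (kermx flow_mx^T).
  rewrite mulf_eq0 subr_eq0 eqr_nat (negPf NE) orbF => /eqP ->.
  rewrite (_ : const_mx 0 = 0) ?sub0mx //; by apply/rowP => j; rewrite !mxE.
transitivity (\rank (const_mx 1 : 'rV[K]_#|X|)); last first.
  rewrite rank_rV; case: eqP => // /rowP/(_ (enum_rank x0)).
  by rewrite !mxE => /eqP; rewrite oner_eq0.
apply/eqmx_rank/andP; split.
  apply/row_subP => i.
  have /sub_kermxP/(flow_mx_left_ker _ x0)[k -> _] :=
    row_sub i (kermx flow_mx^T).
  by rewrite -[k]mulr1 -scalemx_const scalemx_sub.
apply/sub_kermxP/(flow_mx_left_ker _ x0).
by exists 1; rewrite // E subrr mulr0.
Qed.

(** Rank-nullity on both sides: the dimension is the number of arcs plus 1, minus the number of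
    vertices, plus the dimension of the left kernel. *)
Lemma rank_flow_mx_ker : X -> ((\rank (kermx flow_mx))%:Z =
  if cyclomatic e == 1 then 2 else cyclomatic e).
Proof.
move=> x0; have := rank_flow_mx_left_ker x0.
rewrite !mxrank_ker mxrank_tr /cyclomatic -(card_arcs e_graph).
have := rank_leq_row flow_mx; have := rank_leq_col flow_mx.
move: (\rank flow_mx) => r; move: #|arcs e| #|X| => m n.
by case: eqP => [E|NE]; case: eqP => [E'|NE'] /=; lia.
Qed.

End Flows.

Lemma edge_eigenspace_dim (K : numFieldType) (X : finType) (e : rel X) :
  is_graph e -> connected_graph e -> (exists x y, e x y) ->
  has_dim (edge_eigenspace e (1 : K))
    (if cyclomatic e == 1 then 2 else cyclomatic e).
Proof.
move=> eG eC [x0 [y0 xy0]]; rewrite -(rank_flow_mx_ker eG eC K x0).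
(* The constant of the flow is read off at one fixed edge, which makes it linear in u. *)
pose C (u : dedge e -> K^o) := extend u x0 y0 + extend u y0 x0.
pose f (u : dedge e -> K^o) := flow_coords e (extend u) (C u).
have f_lin : linear f.
  move=> k u v; rewrite /f /flow_coords scale_row_mx add_row_mx; congr row_mx.
    by apply/rowP => i; rewrite !mxE extend_lin.
  by rewrite scale_scalar_mx -raddfD /C !extend_lin mulrDr addrACA.
pose F : {linear (dedge e -> K^o) -> 'rV[K]_(#|arcs e| + 1)} :=
  HB.pack f (GRing.isLinear.Build _ _ _ _ f f_lin).
have eig_flow u : edge_eigenspace e 1 u -> is_flow e (extend u) (C u).
  move/edge_eigenspace_succ => /(succ_flow eG eC)/(_ x0) h.
  by rewrite /C (h.2 _ _ xy0).
apply: (has_dim_transfer (f := F)); last exact: has_dim_kermx.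
- by apply/edge_eigenspace_succ => x y _; rewrite big1 /extend => [|c _]; case: insub.
- move=> a u v /edge_eigenspace_succ Eu /edge_eigenspace_succ Ev.
  apply/edge_eigenspace_succ => x y xy; rewrite extend_lin -Eu // -Ev //.
  by rewrite mulr_sumr -big_split /=; apply: eq_bigr => c _; rewrite extend_lin.
- by move=> u /eig_flow/(flow_coords_ker eG).
(* V decodes the arc coordinates of w: the sum has one term if (x, y) is an arc and none
   otherwise. *)
- move=> w w0; pose V x y := \sum_(i | enum_val i == (x, y)) lsubmx w 0 i.
  have wE : w = flow_coords e V (rsubmx w 0 0).
    rewrite -[LHS]hsubmxK; congr row_mx; last by rewrite -mx11_scalar.
    apply/rowP => i; rewrite !mxE /V -surjective_pairing (big_pred1 i) ?mxE // => j.
    by rewrite (inj_eq enum_val_inj).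
  have Vflow : is_flow e (coords_flow e V (rsubmx w 0 0)) (rsubmx w 0 0).
    by apply: ker_coords_flow => //; rewrite -wE.
  exists (fun a => coords_flow e V (rsubmx w 0 0) (val a).1 (val a).2).
    exact: restrict_flow Vflow.
  rewrite /F /= /f /C !extend_restrict //; last by case: eG => ->.
  rewrite (Vflow.2 _ _ xy0) [RHS]wE; congr row_mx; apply/rowP => i; rewrite !mxE.
  have := enum_valP i; rewrite inE => oi.
  by rewrite extend_restrict ?(oriented_edge oi) // /coords_flow oi.
(* Vanishing on arcs and a zero constant force vanishing on the reversed arcs. *)
- move=> u Eu /eqP; rewrite /F /= /f /flow_coords row_mx_eq0.
  have [_ anti] := eig_flow _ Eu.
  move=> /andP[/eqP/rowP u0 /eqP/rowP/(_ 0)]; rewrite !mxE eqxx mulr1n => C0.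
  have u_arc x y : oriented e x y -> extend u x y = 0.
    move=> xy; have A : (x, y) \in arcs e by rewrite inE.
    by have := u0 (enum_rank_in A (x, y)); rewrite !mxE enum_rankK_in.
  apply/funext => a; rewrite -extend_val.
  have aE := valP a; have := orientedN eG aE.
  case: (boolP (oriented e (val a).1 (val a).2)) => [/u_arc -> //|_ /u_arc u0a].
  by have := anti _ _ aE; rewrite u0a addr0 C0.
Qed.

(** An edge arriving at x from y continues without backtracking, which yields a neighbour of x other
    than y. *)
Lemma degree_ge2 (X : finType) (e : rel X) x : is_graph e -> connected_graph e ->
  (exists x y, e x y) -> no_dead_ends e -> (2 <= #|[set y | e x y]%SET|)%N.
Proof.
move=> [es _] eC [a [b ab]] nde.
have : exists y, e x y.
  apply: (connected_ind eC (x := a) (P := fun x => exists y, e x y)); last by exists b.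
  by move=> y z yz _; exists y; rewrite es.
move=> [y xy]; have [q nq [q0 q1]] : exists2 q, nbpath e q & q 0%N = y /\ q 1%N = x.
  by apply: nde; rewrite es.
have [[xz _] [_ zy]] := (nq 1%N, nq 0%N).
rewrite q1 in xz; rewrite q0 in zy.
rewrite (cardsD1 y) inE xy (cardsD1 (q 2%N)) !inE xz.
by move/eqP: zy => ->.
Qed.

(** The degrees are at least 2 and sum to twice the number of vertices, so they all equal 2 and the
    constant k / 2 satisfies both flow equations. *)
Lemma half_flow (K : numFieldType) (X : finType) (e : rel X) (k : K) :
  is_graph e -> connected_graph e -> (exists x y, e x y) -> no_dead_ends e ->
  #|arcs e| = #|X| -> is_flow e (fun _ _ => k / 2) k.
Proof.
move=> eG eC ex nde E.
have degE x : #|[set y | e x y]%SET| = (\sum_(y | e x y) 1)%N.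
  by rewrite -sum1_card; apply: eq_bigl => y; rewrite inE.
have deg2 x : #|[set y | e x y]%SET| = 2.
  (* The equality case of the summed inequality gives equality at every vertex. *)
  have [_] := leqif_sum (P := predT)
    (fun x _ => leqif_eq (degree_ge2 x eG eC ex nde)).
  rewrite sum_nat_const (eq_bigr _ (fun x _ => degE x)).
  rewrite [X in _ == X](sum_degrees eG (fun _ _ => 1%N)) sum_nat_const E eqxx.
  by move=> /esym/forallP/(_ x)/implyP/(_ isT)/eqP.
split=> [x|x y _]; last by rewrite -splitr.
by rewrite sumr_const -cardsE deg2 mulr2n -splitr.
Qed.

Lemma flow_total_eq0 (K : numFieldType) (X : finType) (e : rel X) U (k : K) :
  is_graph e -> #|arcs e| <> #|X| -> is_flow e U k -> k = 0.
Proof.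
move=> eG NE /(flow_massE eG)/eqP; rewrite -subr_eq0 -mulrBl mulf_eq0 subr_eq0.
by rewrite eqr_nat => /orP[/eqP/esym//|/eqP].
Qed.

(** * Invariant distributions and flows *)

Section Assembly.
Variables (X : finType) (e : rel X) (Xt : choiceType) (et : rel Xt).
Variables (p : Xt -> X) (o : Xt).
Hypothesis cover : is_universal_cover e et p.
Hypotheses (e_graph : is_graph e) (e_conn : connected_graph e).
Hypotheses (e_edge : exists x y, e x y) (nde : no_dead_ends e).
Variable K : numFieldType.
Local Notation functional := (loc_const_fun K et -> K^o).
Local Notation inv := (inv_distribution et p o (1 : K)).

Definition base_lift x := xget o [set xt | p xt = x].

Lemma base_liftK x : p (base_lift x) = x.
Proof.
have [y yx] := cover_surj cover x.
by rewrite /base_lift; case: xgetP => [? -> //|/(_ y)].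
Qed.

Definition mass_fun (mu : functional) : dedge e -> K^o := fun a =>
  edge_mass mu (base_lift (val a).1)
    (lift_at et p (base_lift (val a).1) (val a).2).

Lemma mass_fun_linear : linear mass_fun.
Proof. by []. Qed.

HB.instance Definition _ :=
  GRing.isLinear.Build K functional (dedge e -> K^o) _ mass_fun mass_fun_linear.

(** Deck transformations act transitively on the lifts of an edge, so invariance makes the mass
    independent of the lift chosen in [mass_fun]. *)
Lemma extend_mass_fun mu x y : inv mu -> et x y ->
  extend (mass_fun mu) (p x) (p y) = edge_mass mu x y.
Proof.
move=> mu_inv xy; rewrite /extend insubT ?(cover_edge cover) //= => pxy.
rewrite /mass_fun /=.
have [|sl pl] := @liftP _ _ _ _ _ cover (base_lift (p x)) (p y).
  by rewrite base_liftK.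
by apply/esym/(edge_mass_deck cover mu_inv) => //; rewrite base_liftK.
Qed.

Lemma mass_fun_succ mu : inv mu -> forall x y, e x y ->
  \sum_(c | e y c && (c != x)) extend (mass_fun mu) y c =
  extend (mass_fun mu) x y.
Proof.
move=> mu_inv x y xy.
have [|] := @liftP _ _ _ _ _ cover (base_lift x) y; first by rewrite base_liftK.
set z := lift_at _ _ _ _ => xz zy.
rewrite -[in RHS](base_liftK x) -[in RHS]zy extend_mass_fun //.
rewrite -(edge_mass_succ cover mu_inv.1 xz) base_liftK zy.
apply: eq_bigr => c /andP[yc _].
have [|zc pc] := @liftP _ _ _ _ _ cover z c; first by rewrite zy.
by rewrite -(extend_mass_fun mu_inv zc) zy pc.
Qed.

Lemma mass_fun_flow mu : inv mu ->
  is_flow e (extend (mass_fun mu)) (integral mu (fun=> 1)).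
Proof.
move=> mu_inv; have := succ_flow e_graph e_conn (mass_fun_succ mu_inv) (p o).
rewrite -(edge_mass_total cover mu_inv.1 o).
congr (is_flow _ _ _); apply: eq_bigr => c oc.
have [ol pl] := liftP cover oc.
by rewrite -(extend_mass_fun mu_inv ol) pl.
Qed.

Lemma inv_distribution_lin k (mu nu : functional) :
  inv mu -> inv nu -> inv (k *: mu + nu).
Proof.
move=> [mu_lin mu_inv] [nu_lin nu_inv]; split.
  move=> a f g; rewrite -[LHS]/(k * mu _ + nu _) mu_lin nu_lin.
  rewrite -[X in _ = _ * X + _]/(k * mu f + nu f) -[X in _ = _ + X]/(k * mu g + nu g).
  ring.
move=> g gD; rewrite -[in RHS](mu_inv g gD) -[in RHS](nu_inv g gD).
by [].
Qed.

Lemma inv_distribution0 : inv 0.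
Proof.
by split=> [a f g|g gD] //; rewrite -[RHS]/(a * 0 + 0) mulr0 addr0.
Qed.

Lemma mass_fun_surj (u : dedge e -> K^o) : edge_eigenspace e 1 u ->
  exists2 mu, inv mu & mass_fun mu = u.
Proof.
move=> /edge_eigenspace_succ us.
exists (flow_measure e p o (extend u)); first exact: flow_measure_inv.
apply/funext => a; rewrite /mass_fun.
have [|sl pl] := @liftP _ _ _ _ _ cover (base_lift (val a).1) (val a).2.
  by rewrite base_liftK; exact: (valP a).
by rewrite (flow_measure_edge_mass cover nde) // base_liftK pl extend_val.
Qed.

Lemma mass_fun_inj mu : inv mu -> mass_fun mu = 0 -> mu = 0.
Proof.
move=> mu_inv mu0; apply: (distribution_eq0 cover o mu_inv.1) => x y xy.
rewrite -(extend_mass_fun mu_inv xy) mu0 /extend.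
by case: insub.
Qed.

Lemma inv_distribution_dim :
  has_dim inv (if cyclomatic e == 1 then 2 else cyclomatic e).
Proof.
apply: (has_dim_transfer (f := mass_fun)); last exact: edge_eigenspace_dim.
- exact: inv_distribution0.
- exact: inv_distribution_lin.
- by move=> mu /mass_fun_succ Emu; apply/edge_eigenspace_succ.
- exact: mass_fun_surj.
- exact: mass_fun_inj.
Qed.

Lemma vertex_poisson_total mu : vertex_poisson et p o (1 : K) mu =
  fun=> integral mu (fun=> 1).
Proof.
apply/funext => x; rewrite /vertex_poisson /poisson.
by congr integral; apply/funext => w; rewrite exp1rz.
Qed.

Lemma cyclomatic_eq1 : (cyclomatic e == 1) = (#|arcs e| == #|X|).
Proof. by rewrite /cyclomatic -(card_arcs e_graph); lia. Qed.

Lemma integral1_eq0 mu : cyclomatic e != 1 -> inv mu ->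
  integral mu (fun=> 1) = 0.
Proof.
rewrite cyclomatic_eq1 => /eqP NE /mass_fun_flow.
exact: flow_total_eq0.
Qed.

Lemma exists_integral1 k : cyclomatic e == 1 ->
  exists2 mu, inv mu & integral mu (fun=> 1) = k.
Proof.
rewrite cyclomatic_eq1 => /eqP E.
have kflow := half_flow k e_graph e_conn e_edge nde E.
have [mu mu_inv muE] := mass_fun_surj (restrict_flow e_graph kflow).
exists mu => //; rewrite -((mass_fun_flow mu_inv).1 (p o)) -(kflow.1 (p o)) muE.
by apply: eq_bigr => c oc; rewrite (extend_restrict (fun _ _ => k / 2)).
Qed.

(** The image consists of constant functions whose value is the total mass: always 0 if the
    cyclomatic number is not 1, arbitrary otherwise. *)
Lemma poisson_image_dim :
  has_dim (vertex_poisson et p o (1 : K) @` inv)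
    (if cyclomatic e == 1 then 1 else 0).
Proof.
case: ifPn => c1.
  exists 1%N, (fun _ _ => 1 : K^o); split=> // [c|v].
    rewrite big_ord1 => /(congr1 (@^~ (p o))) c0 i.
    by move: c0; rewrite (ord1 i) -[LHS]/(c 0 * 1) mulr1.
  split=> [[mu mu_inv <-]|[c ->]].
    exists (fun=> integral mu (fun=> 1)); rewrite big_ord1 vertex_poisson_total.
    by apply/funext => x; rewrite -[RHS]/(_ * 1) mulr1.
  have [mu mu_inv mu1] := exists_integral1 (c 0) c1.
  exists mu; rewrite // big_ord1 vertex_poisson_total mu1.
  by apply/funext => x; rewrite -[RHS]/(_ * 1) mulr1.
exists 0%N, (fun _ _ => 0 : K^o); split=> // [c _ [] //|v].
split=> [[mu mu_inv <-]|[c ->]].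
  exists (fun=> 0); rewrite big_ord0 vertex_poisson_total integral1_eq0 //.
exists 0; first exact: inv_distribution0.
by rewrite big_ord0 vertex_poisson_total.
Qed.

(** Surjectivity fails when the cyclomatic number is not 1, since the image is zero while the
    constant 1 is an eigenfunction. Otherwise injectivity fails, a two-dimensional space being sent
    to constants. *)
Lemma poisson_not_bij :
  ~ set_bij inv (vertex_eigenspace e (1 : K)) (vertex_poisson et p o (1 : K)).
Proof.
move=> [_ inj surj]; have [c1|c1] := boolP (cyclomatic e == 1); last first.
  have [|mu mu_inv] := surj (fun=> 1).
    move=> x; rewrite /laplacian /chi sumr_const invr1 !mulr1 /branching cardsE.
    by rewrite [1 + _]addrC subrK mulrC.
  rewrite vertex_poisson_total integral1_eq0 // => /(congr1 (@^~ (p o))) /eqP.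
  by rewrite eq_sym oner_eq0.
have := inv_distribution_dim; rewrite c1 => -[n [b [[nE] free span]]].
case: n nE b free span => [|[|[|//]]] // _ b free span.
have b_inv i : inv (b i).
  apply/span; exists (fun j => (j == i)%:R).
  by rewrite (bigD1 i) //= eqxx scale1r big1 ?addr0 // => j /negPf ->; rewrite scale0r.
have ker0 mu : inv mu -> integral mu (fun=> 1) = 0 -> mu = 0.
  move=> mu_inv mu0; apply: inj; rewrite ?inE //; first exact: inv_distribution0.
  by rewrite !vertex_poisson_total mu0.
pose m i := integral (b i) (fun=> 1).
(* This combination of the two basis vectors has total mass zero, so injectivity and freeness force
   both coefficients to vanish. *)
pose c (i : 'I_2) := if i == 0 then m 1 else - m 0.
have c0 : forall i, c i = 0.
  apply: (free c); rewrite big_ord_recl big_ord1 /c eqxx /=.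
  rewrite (_ : lift ord0 ord0 = 1); last exact: val_inj.
  apply: ker0.
    apply: inv_distribution_lin => //; rewrite -[_ *: _]addr0.
    by apply: inv_distribution_lin => //; exact: inv_distribution0.
  rewrite -[LHS]/(m 1 * m 0 + - m 0 * m 1); ring.
(* From c 1 = 0 the first basis vector has total mass zero, hence is zero, against freeness. *)
have b0 : b 0 = 0.
  by apply: ker0 => //; apply/eqP; rewrite -oppr_eq0; apply/eqP; exact: (c0 1).
have := free (fun i : 'I_2 => (i == 0)%:R); rewrite big_ord_recl big_ord1 /= scale0r.
rewrite addr0 scale1r b0 => /(_ erefl 0)/eqP.
by rewrite oner_eq0.
Qed.

End Assembly.

Theorem theoremC (R : realType) (X : finType) (e : rel X)
    (Xt : choiceType) (et : rel Xt) (p : Xt -> X) (o : Xt) :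
  is_graph e -> connected_graph e -> (exists x y, e x y) -> no_dead_ends e ->
  is_universal_cover e et p ->
  [/\ ~ set_bij (inv_distribution et p o (1 : R[i]))
                (vertex_eigenspace e (1 : R[i]))
                (vertex_poisson et p o (1 : R[i])),
      has_dim (vertex_poisson et p o (1 : R[i]) @`
                 inv_distribution et p o (1 : R[i]))
        (if cyclomatic e == 1 then 1 else 0),
      has_dim (inv_distribution et p o (1 : R[i]))
        (if cyclomatic e == 1 then 2 else cyclomatic e) &
      has_dim (edge_eigenspace e (1 : R[i]))
        (if cyclomatic e == 1 then 2 else cyclomatic e)].
Proof.
move=> eG eC e_edge nde cover; split.
- exact: poisson_not_bij.
- exact: poisson_image_dim.
- exact: inv_distribution_dim.
- exact: edge_eigenspace_dim.
Qed.
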